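(* Let $\sigma_n=n^{-a}$ for some $a\in(0,1/14)$, and let $(a_n(\omega))_{n\in\mathbb N}$ be the associated random sequence (see context). Then there is a set $\Omega_0\in\mathcal F$ with $\mathbb P(\Omega_0)=1$ such that for every $\omega\in\Omega_0$ the following holds: for every probability space $(X,\mathcal X,\mu)$, every pair of commuting measure preserving transformations $T,S\colon X\to X$, and all $f,g\in L^\infty(\mu)$, for $\mu$-almost every $x\in X$, $$\lim_{N\to\infty}\frac1N\sum_{n=1}^N f(T^nx)\, g(S^{a_n(\omega)}x)=\tilde f(x)\,\tilde g(x),$$ where $\tilde f=\mathbb E(f\mid\mathcal I(T))=\lim_{N\to\infty}\frac1N\sum_{n=1}^N f\circ T^n$ and $\tilde g=\mathbb E(g\mid\mathcal I(S))=\lim_{N\to\infty}\frac1N\sum_{n=1}^N g\circ S^n$.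
   Context: Random setup: $(\Omega,\mathcal F,\mathbb P)$ is a probability space and $(X_n)_{n\in\mathbb N}$ are independent random variables with $\mathbb P(X_n=1)=\sigma_n$, $\mathbb P(X_n=0)=1-\sigma_n$, where $\sigma_n\in[0,1]$. The random sequence $(a_n(\omega))_{n\in\mathbb N}$ lists the positive integers $k$ with $X_k(\omega)=1$ in increasing order; equivalently $a_n(\omega)$ is the smallest $k\in\mathbb N$ with $X_1(\omega)+\dots+X_k(\omega)=n$. For a measure preserving transformation $T$, $\mathcal I(T)$ denotes the $\sigma$-algebra of $T$-invariant sets and $\mathbb E(\cdot\mid\mathcal I(T))$ the conditional expectation. *)

(* Defs.v *)
From HB Require Import structures.
From mathcomp Require Import all_boot all_order all_algebra.
From mathcomp Require Import all_classical all_reals all_analysis.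
Set Implicit Arguments. Unset Strict Implicit. Unset Printing Implicit Defensive.
Import Order.TTheory GRing.Theory Num.Theory.
Local Open Scope classical_set_scope.
Local Open Scope ring_scope.

Definition indep_seq (d : measure_display) (Omega : measurableType d)
  (R : realType) (P : probability Omega R) (X : nat -> Omega -> R) : Prop :=
  forall (J : seq nat) (B : nat -> set R),
    uniq J -> (forall j, j \in J -> (0 < j)%N) -> (forall j, measurable (B j)) ->
    P (\bigcap_(j in [set j | j \in J]) (X j @^-1` B j)) =
    (\prod_(j <- J) P (X j @^-1` B j))%E.

Definition partial_count (R : realType) (Omega : Type) (X : nat -> Omega -> R)
  (w : Omega) (k : nat) : R := \sum_(1 <= j < k.+1) X j w.

(* a_n(ω) = the smallest k with X_1(ω)+...+X_k(ω) = n  (default 0 if none). *)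
Definition rand_seq (R : realType) (Omega : Type) (X : nat -> Omega -> R)
  (w : Omega) (n : nat) : nat :=
  xget 0%N [set k | partial_count X w k = n%:R /\
                    forall j, (j < k)%N -> partial_count X w j <> n%:R].

Definition invariant_sets (d : measure_display) (Y : measurableType d)
  (T : Y -> Y) : set (set Y) :=
  [set A | measurable A /\ T @^-1` A = A].

Definition is_cond_exp_inv (d : measure_display) (Y : measurableType d)
  (R : realType) (mu : probability Y R) (T : Y -> Y) (f h : Y -> R) : Prop :=
  (forall B : set R, measurable B -> invariant_sets T (h @^-1` B)) /\
  mu.-integrable setT (fun x => (h x)%:E) /\
  (forall A, invariant_sets T A ->
     (\int[mu]_(x in A) (h x)%:E = \int[mu]_(x in A) (f x)%:E)%E).

Definition measure_preserving (d : measure_display) (Y : measurableType d)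
  (R : realType) (mu : probability Y R) (T : Y -> Y) : Prop :=
  measurable_fun setT T /\ forall A, measurable A -> mu (T @^-1` A) = mu A.

Definition Linfty (d : measure_display) (Y : measurableType d)
  (R : realType) (mu : probability Y R) (f : Y -> R) : Prop :=
  measurable_fun setT f /\ exists M : R, {ae mu, forall x, `|f x| <= M}.

(* Main.v *)
Require Import Defs.
From HB Require Import structures.
From mathcomp Require Import all_boot all_order all_algebra.
From mathcomp Require Import all_classical all_reals all_analysis measurable_realfun.
From mathcomp Require Import ring lra zify.
Import Order.TTheory GRing.Theory Num.Theory.
Import numFieldNormedType.Exports.
Local Open Scope classical_set_scope.
Local Open Scope ring_scope.
Set Implicit Arguments. Unset Strict Implicit. Unset Printing Implicit Defensive.

(** Write [W N] for the sum of the first [N] densities. Counting by [k = a_n],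
the average in question is, up to the factor [cnt N / W N -> 1], the sum of
[X_k f(T^(X_1+...+X_k) x) g(S^k x)] over [k <= N] divided by [W N].

First, [X_k] is replaced by its mean [sigma_k]. The squared L^2 norm of the sum
with weights [Y_k = X_k - sigma_k] is bounded, uniformly over all systems, by a
quantity depending on [omega] only: van der Corput's inequality is used twice,
first to decouple [g], then, after shifting by [T^(B - b_k)] (so that no
invertibility is needed), to eliminate [f]. What remains are sums of products
[Y_k phi(X_(k+1), X_(k+2), ...)], which are orthogonal. For [a < 1/14] the
resulting bound is summable along [N = k^q], and the gaps between consecutive
such [N] are filled because [cnt] and [W] grow regularly.

Second, [g = gt + h] with [h] of zero conditional expectation. For the part [gt]
the first step with [g = 1] brings back the ordinary Birkhoff averages of [f].
For the part [h], the weights [sigma_k f(T^(X_1+...+X_k) x)] vary so slowly that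
[h] can be replaced by its averages over blocks of length [L]; these are small in
L^1 by the ergodic theorem, and the maximal inequality concludes. *)

(** * Bounded measurable functions *)

(** The obstacle is the order of quantifiers: [Omega0] is fixed before the system, so no expectation
    over omega may involve [T], [S], [f] or [g]. The system is separated from omega as follows.
    After each use of van der Corput, the factor carrying the system depends on [n] only through the
    number of selected times in a short window after [n]. Grouping the indices by this number takes
    that factor out of the sum over [n]; as it is bounded by 1, AM-GM trades it for a constant plus
    a square in which it no longer occurs. Grouping is cheap, since each [n] lies in a single class.

    The exponent 1/14 comes from balancing. Put x = N^a, so that W is of order N/x, and ask for a
    gain t over W^2. The outer diagonal forces M = x t; keeping the outer constant term of size W
    gives l = N/(x^3 t^2). The inner bound must then be of order N^2/(x^5 t^3), and the inner
    diagonal forces M' = x^4 t^3. With l' = M' the orthogonal part is of size W, while the inner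
    constant term is of order M M'^3 = x^13 t^10, which has to stay below N/x. Hence N = x^14
    t^10. *)

Definition bmf d (Y : measurableType d) (R : realType) (u : Y -> R) : Prop :=
  measurable_fun setT u /\ exists C : R, forall x, `|u x| <= C.

Section BoundedMeasurable.
Context {d : measure_display} {Y : measurableType d} {R : realType}.
Implicit Types u v : Y -> R.

Lemma bmf_cst (c : R) : bmf (fun _ : Y => c).
Proof. by split; [exact: measurable_cst | exists `|c|]. Qed.

Lemma bmfD u v : bmf u -> bmf v -> bmf (fun x => u x + v x).
Proof.
move=> [mu [C hC]] [mv [D hD]]; split; first exact: measurable_funD.
by exists (C + D) => x; apply: (le_trans (ler_normD _ _)); exact: lerD.
Qed.

Lemma bmfM u v : bmf u -> bmf v -> bmf (fun x => u x * v x).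
Proof.
move=> [mu [C hC]] [mv [D hD]]; split; first exact: measurable_funM.
by exists (C * D) => x; rewrite normrM; exact: ler_pM.
Qed.

Lemma bmfN u : bmf u -> bmf (fun x => - u x).
Proof.
by move=> [mu [C hC]]; split; [exact: measurableT_comp | exists C => x; rewrite normrN].
Qed.

Lemma bmfB u v : bmf u -> bmf v -> bmf (fun x => u x - v x).
Proof. by move=> hu hv; apply: bmfD => //; exact: bmfN. Qed.

Lemma bmfZ (c : R) u : bmf u -> bmf (fun x => c * u x).
Proof. by move=> hu; apply: bmfM => //; exact: bmf_cst. Qed.

Lemma bmf_sqr u : bmf u -> bmf (fun x => u x ^+ 2).
Proof. by move=> hu; apply: bmfM. Qed.

Lemma bmf_norm u : bmf u -> bmf (fun x => `|u x|).
Proof.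
by move=> [mu [C hC]]; split; [exact: measurableT_comp | exists C => x; rewrite normr_id].
Qed.

Lemma bmf_max u v : bmf u -> bmf v -> bmf (fun x => Num.max (u x) (v x)).
Proof.
move=> [mu [C hC]] [mv [D hD]]; split; first exact: measurable_maxr.
exists (Num.max C D) => x; rewrite le_max.
by case: (leP (u x) (v x)) => _; rewrite ?hC ?hD ?orbT.
Qed.

Lemma bmf_indic (A : set Y) : measurable A -> bmf (\1_A : Y -> R).
Proof.
move=> mA; split; first exact: measurable_indic.
by exists 1 => x; rewrite indicE; case: (_ \in _); rewrite ?normr1 ?normr0.
Qed.

Lemma bmf_sum (I : Type) (r : seq I) (Q : pred I) (F : I -> Y -> R) :
  (forall i, Q i -> bmf (F i)) -> bmf (fun x => \sum_(i <- r | Q i) F i x).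
Proof.
move=> hF; elim: r => [|i r IH].
  have -> : (fun x => \sum_(i <- [::] | Q i) F i x) = fun=> 0.
    by apply/funext => x; rewrite big_nil.
  exact: bmf_cst.
have -> : (fun x => \sum_(j <- i :: r | Q j) F j x) =
    (fun x => (if Q i then F i x else 0) + \sum_(j <- r | Q j) F j x).
  by apply/funext => x; rewrite big_cons; case: ifP; rewrite ?add0r.
apply: bmfD => //; case Qi: (Q i); [exact: hF | exact: bmf_cst].
Qed.

Lemma bmf_comp (T : Y -> Y) u : measurable_fun setT T -> bmf u ->
  bmf (fun x => u (T x)).
Proof.
by move=> mT [mu [C hC]]; split; [exact: (measurableT_comp mu) | exists C].
Qed.

Variable mu : probability Y R.

Lemma bmf_integrable u : bmf u -> mu.-integrable setT (EFin \o u).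
Proof.
move=> [mu_ [C hC]]; apply: measurable_bounded_integrable => //.
  by apply: le_lt_trans (probability_le1 _ _) _; rewrite ?ltry.
exists C; split; first exact: num_real.
by move=> M CM x _ /=; exact: le_trans (hC x) (ltW CM).
Qed.

Lemma meanD u v : bmf u -> bmf v ->
  \int[mu]_x (u x + v x) = \int[mu]_x u x + \int[mu]_x v x.
Proof. by move=> hu hv; apply: RintegralD => //; exact: bmf_integrable. Qed.

Lemma meanB u v : bmf u -> bmf v ->
  \int[mu]_x (u x - v x) = \int[mu]_x u x - \int[mu]_x v x.
Proof. by move=> hu hv; apply: RintegralB => //; exact: bmf_integrable. Qed.

Lemma meanZ (c : R) u : bmf u -> \int[mu]_x (c * u x) = c * \int[mu]_x u x.
Proof. by move=> hu; apply: RintegralZl => //; exact: bmf_integrable. Qed.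

Lemma mean_cst (c : R) : \int[mu]_x (fun=> c) x = c.
Proof.
rewrite Rintegral_cst// (_ : fine _ = 1) ?mulr1//.
by rewrite -[RHS]/(fine 1%E); congr fine; exact: probability_setT.
Qed.

Lemma mean_sum (I : Type) (r : seq I) (Q : pred I) (F : I -> Y -> R) :
  (forall i, Q i -> bmf (F i)) ->
  \int[mu]_x (\sum_(i <- r | Q i) F i x) = \sum_(i <- r | Q i) \int[mu]_x F i x.
Proof.
move=> hF; elim: r => [|i r IH].
  rewrite big_nil -[RHS]mean_cst; apply: eq_Rintegral => x _.
  by rewrite big_nil.
rewrite big_cons; case: ifP => Qi; last first.
  by rewrite -IH; apply: eq_Rintegral => x _; rewrite big_cons Qi.
rewrite -IH -meanD; [|exact: hF|exact: bmf_sum].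
by apply: eq_Rintegral => x _; rewrite big_cons Qi.
Qed.

Lemma le_mean u v : bmf u -> bmf v -> (forall x, u x <= v x) ->
  \int[mu]_x u x <= \int[mu]_x v x.
Proof. by move=> hu hv uv; apply: le_Rintegral => //; exact: bmf_integrable. Qed.

Lemma mean_le_cst u (c : R) : bmf u -> (forall x, u x <= c) -> \int[mu]_x u x <= c.
Proof.
move=> hu uc; rewrite -[leRHS](mean_cst c); apply: le_mean => //; exact: bmf_cst.
Qed.

Lemma mean_norm_le u (c : R) : bmf u -> (forall x, `|u x| <= c) ->
  `|\int[mu]_x u x| <= c.
Proof.
move=> hu uc; apply: le_trans (mean_le_cst (bmf_norm hu) uc).
by apply: le_normr_Rintegral => //; exact: bmf_integrable.
Qed.

Lemma mean_indic (A : set Y) : measurable A ->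
  \int[mu]_x (\1_A x) = fine (mu A).
Proof. by move=> mA; rewrite /Rintegral integral_indic// setIT. Qed.

Lemma mean_comp (T : Y -> Y) u : measure_preserving mu T -> bmf u ->
  \int[mu]_x (u (T x)) = \int[mu]_x u x.
Proof.
move=> [mT pT] hu; rewrite /Rintegral; congr fine.
have mu_ : measurable_fun setT (EFin \o u).
  by apply: measurableT_comp => //; case: hu.
have iT : mu.-integrable (T @^-1` setT) ((EFin \o u) \o T).
  by rewrite preimage_setT; exact: bmf_integrable (bmf_comp mT hu).
transitivity (\int[pushforward mu T]_x (u x)%:E)%E.
  by rewrite (integral_pushforward mT mu_ iT)// preimage_setT.
by apply: eq_measure_integral => A mA _; exact: pT.
Qed.

End BoundedMeasurable.

Lemma measure_preserving_iter d (Y : measurableType d) (R : realType)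
  (mu : probability Y R) (T : Y -> Y) n :
  measure_preserving mu T -> measure_preserving mu (iter n T).
Proof.
move=> [mT pT]; elim: n => [|n [mn pn]].
  by split; [exact: measurable_id | move=> A _].
split; first exact: measurableT_comp.
move=> A mA; have -> : iter n.+1 T @^-1` A = iter n T @^-1` (T @^-1` A) by [].
by rewrite pn ?pT// -[T @^-1` A]setTI; exact: mT.
Qed.

(** * Van der Corput's inequality *)

Lemma sqr_sum_le (R : realFieldType) (z : nat -> R) K :
  (\sum_(0 <= p < K) z p) ^+ 2 <= K%:R * \sum_(0 <= p < K) z p ^+ 2.
Proof.
elim: K => [|K IH]; first by rewrite !big_geq// expr0n mul0r.
rewrite !big_nat_recr//=; set S := \sum_(0 <= p < K) z p in IH *.
set Q := \sum_(0 <= p < K) _ in IH *.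
(* The inductive step of Cauchy-Schwarz: the difference of the two sides is the sum of the squares
   [(z p - z K) ^+ 2]. *)
have H2 : 2 * S * z K <= Q + K%:R * z K ^+ 2.
  rewrite -subr_ge0 [leRHS](_ : _ = \sum_(0 <= p < K) (z p - z K) ^+ 2).
    by apply: sumr_ge0 => p _; exact: sqr_ge0.
  under [RHS]eq_bigr do rewrite sqrrB.
  rewrite big_split/= sumrB -/Q sumr_const_nat subn0.
  have -> : \sum_(0 <= i < K) z i * z K *+ 2 = 2 * S * z K.
    by rewrite -mulrA /S mulr_suml mulr_sumr; apply: eq_bigr => i _; rewrite mulr_natl.
  by rewrite -mulr_natl; ring.
rewrite -natr1; nra.
Qed.

Lemma sqr_sum_expand (R : realFieldType) (z : nat -> R) K :
  (\sum_(0 <= p < K) z p) ^+ 2 =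
  \sum_(0 <= p < K) z p ^+ 2 + 2 * \sum_(0 <= p < K) \sum_(0 <= q < p) z p * z q.
Proof.
elim: K => [|K IH]; first by rewrite !big_geq// expr0n mulr0 addr0.
by rewrite !big_nat_recr//= sqrrD IH -mulr_sumr; ring.
Qed.

(** A window of length [N + M] contains every translate of the support by at most [M], so nothing is
    lost at the right end; the guard prevents truncated subtraction from reading [F 0] for all
    [p < h]. *)
Lemma sum_shift (R : realFieldType) (F : nat -> R) N M h :
  (forall n, (N <= n)%N -> F n = 0) -> (h <= M)%N ->
  \sum_(0 <= p < N + M) (if (h <= p)%N then F (p - h)%N else 0) =
  \sum_(0 <= n < N) F n.
Proof.
move=> hF hM; have hNM : (h <= N + M)%N by rewrite (leq_trans hM)// leq_addl.
rewrite (big_cat_nat (leq0n h) hNM)/= big_nat_cond big1 ?add0r; last first.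
  by move=> p /andP[/andP[_ ph] _]; rewrite leqNgt ph.
rewrite -{1}[h]add0n big_addn.
have hN : (N <= N + M - h)%N by lia.
rewrite (big_cat_nat (leq0n N) hN)/=.
rewrite [X in _ + X]big_nat_cond [X in _ + X]big1 ?addr0; last first.
  by move=> p /andP[/andP[Np _] _]; rewrite leq_addl addnK hF.
by apply: eq_bigr => p _; rewrite leq_addl addnK.
Qed.

(** Summing the [M] translates of [u] gives [M] times its sum, and at each point [p] they form a sum
    of [M] terms. Cauchy-Schwarz over the [N + M] points [p], followed by expansion of the square,
    leaves only correlations at lags below [M]. *)
Lemma van_der_corput (R : realFieldType) (u : nat -> R) N M :
  (forall n, (N <= n)%N -> u n = 0) ->
  (M%:R * \sum_(0 <= n < N) u n) ^+ 2 <=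
  (N + M)%:R * (M%:R * \sum_(0 <= n < N) u n ^+ 2 +
    2 * \sum_(0 <= h < M) \sum_(0 <= k < h) \sum_(0 <= n < N) u n * u (n + (h - k))%N).
Proof.
move=> hu; pose w h p := if (h <= p)%N then u (p - h)%N else 0.
have -> : M%:R * \sum_(0 <= n < N) u n =
    \sum_(0 <= p < N + M) \sum_(0 <= h < M) w h p.
  rewrite [RHS]exchange_big_nat/= [RHS](@eq_big_nat _ _ _ _ _ _ (fun=> \sum_(0 <= n < N) u n)).
    by rewrite sumr_const_nat subn0 mulr_natl.
  by move=> h /andP[_ hM]; rewrite -(sum_shift hu (ltnW hM)).
apply: (le_trans (sqr_sum_le _ _)); rewrite ler_wpM2l//.
under eq_bigr do rewrite sqr_sum_expand.
rewrite big_split/= -mulr_sumr le_eqVlt; apply/orP; left; apply/eqP.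
congr (_ + 2 * _).
  rewrite [LHS]exchange_big_nat/= [LHS](@eq_big_nat _ _ _ _ _ _ (fun=> \sum_(0 <= n < N) u n ^+ 2)).
    by rewrite sumr_const_nat subn0 mulr_natl.
  move=> h /andP[_ hM].
  rewrite -(@sum_shift _ (fun n => u n ^+ 2) N M h) ?(ltnW hM)//; last first.
    by move=> n /hu ->; rewrite expr0n.
  by apply: eq_bigr => p _; rewrite /w; case: ifP; rewrite ?expr0n.
rewrite exchange_big_nat/=; apply: eq_big_nat => h /andP[_ hM].
rewrite exchange_big_nat/=; apply: eq_big_nat => k /andP[_ kh].
rewrite -(@sum_shift _ (fun n => u n * u (n + (h - k))%N) N M h) ?(ltnW hM)//; last first.
  by move=> n /hu ->; rewrite mul0r.
apply: eq_bigr => p _; rewrite /w; case: ifP => hp; last by rewrite mul0r.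
by rewrite (leq_trans (ltnW kh) hp); congr (_ * u _); lia.
Qed.

Lemma van_der_corput_mean d (Y : measurableType d) (R : realType)
  (mu : probability Y R) (u : nat -> Y -> R) N M : (0 < M)%N ->
  (forall n, bmf (u n)) -> (forall n x, (N <= n)%N -> u n x = 0) ->
  \int[mu]_x ((\sum_(0 <= n < N) u n x) ^+ 2) <=
  (N + M)%:R / M%:R * (\sum_(0 <= n < N) \int[mu]_x (u n x ^+ 2) +
    2 * \sum_(1 <= m < M) `|\sum_(0 <= n < N) \int[mu]_x (u n x * u (n + m)%N x)|).
Proof.
move=> M0 bu hu; have M0R : 0 < M%:R :> R by rewrite ltr0n.
pose c m := \sum_(0 <= n < N) \int[mu]_x (u n x * u (n + m)%N x).
have bs : bmf (fun x => (\sum_(0 <= n < N) u n x) ^+ 2) by apply/bmf_sqr/bmf_sum.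
have bc (m : nat) : bmf (fun x => \sum_(0 <= n < N) u n x * u (n + m)%N x).
  by apply: bmf_sum => n _; exact: bmfM.
have bcc h : bmf (fun x => \sum_(0 <= k < h) \sum_(0 <= n < N) u n x * u (n + (h - k))%N x).
  by apply: bmf_sum => k _; exact: bc.
have b1 : bmf (fun x => M%:R * \sum_(0 <= n < N) u n x ^+ 2).
  by apply/bmfZ/bmf_sum => n _; exact: bmf_sqr.
have b2 : bmf (fun x => 2 * \sum_(0 <= h < M) \sum_(0 <= k < h)
    \sum_(0 <= n < N) u n x * u (n + (h - k))%N x).
  by apply/bmfZ/bmf_sum => h _; exact: bcc.
have H : M%:R ^+ 2 * \int[mu]_x ((\sum_(0 <= n < N) u n x) ^+ 2) <=
    (N + M)%:R * (M%:R * \sum_(0 <= n < N) \int[mu]_x (u n x ^+ 2) +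
      2 * \sum_(0 <= h < M) \sum_(0 <= k < h) c (h - k)%N).
  rewrite -meanZ//.
  have -> : M%:R * \sum_(0 <= n < N) \int[mu]_x (u n x ^+ 2) =
      \int[mu]_x (M%:R * \sum_(0 <= n < N) u n x ^+ 2).
    rewrite meanZ; last by apply/bmf_sum => n _; exact: bmf_sqr.
    by rewrite mean_sum// => n _; exact: bmf_sqr.
  have -> : 2 * \sum_(0 <= h < M) \sum_(0 <= k < h) c (h - k)%N =
      \int[mu]_x (2 * \sum_(0 <= h < M) \sum_(0 <= k < h)
         \sum_(0 <= n < N) u n x * u (n + (h - k))%N x).
    rewrite meanZ; last by apply/bmf_sum => h _; exact: bcc.
    rewrite mean_sum; last by move=> h _; exact: bcc.
    congr (_ * _); apply: eq_bigr => h _; rewrite mean_sum; last by move=> k _; exact: bc.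
    apply: eq_bigr => k _; rewrite mean_sum// => n _; exact: bmfM.
  rewrite -meanD// -meanZ; last exact: bmfD.
  apply: le_mean; [exact: bmfZ|by apply: bmfZ; exact: bmfD|move=> x].
  by rewrite -exprMn; apply: van_der_corput => n; exact: hu.
(* A lag [m] occurs for at most [M] pairs [k < h]; passing to absolute values allows the missing
   pairs to be added. *)
have H2 : \sum_(0 <= h < M) \sum_(0 <= k < h) c (h - k)%N <=
    M%:R * \sum_(1 <= m < M) `|c m|.
  rewrite mulr_natl -[X in _ *+ X]subn0 -sumr_const_nat.
  apply: ler_sum_nat => h /andP[_ hM]; rewrite big_nat_rev/= add0n.
  apply: (@le_trans _ _ (\sum_(1 <= m < h.+1) `|c m|)).
    rewrite big_add1/=; apply: ler_sum_nat => k /andP[_ kh].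
    by rewrite (_ : (h - (h - k.+1) = k.+1)%N) ?ler_norm//; lia.
  rewrite [leRHS](big_cat_nat (ltn0Sn h) hM)/= lerDl; exact: sumr_ge0.
rewrite -(ler_pM2l (exprn_gt0 2 M0R)); apply: (le_trans H).
have -> : M%:R ^+ 2 * ((N + M)%:R / M%:R * (\sum_(0 <= n < N) \int[mu]_x (u n x ^+ 2) +
    2 * \sum_(1 <= m < M) `|c m|)) = (N + M)%:R * (M%:R *
    \sum_(0 <= n < N) \int[mu]_x (u n x ^+ 2) + 2 * (M%:R * \sum_(1 <= m < M) `|c m|)).
  by field; rewrite gt_eqF.
by rewrite ler_wpM2l// lerD2l ler_wpM2l.
Qed.

(** * A bound uniform over commuting systems *)

(** Positions are numbered from 0: index [i] stands for time [i + 1], so [cnt e 0 n.+1] is the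
    exponent of [T] that accompanies [S^(n+1)]. *)
Definition cnt (e : nat -> bool) (p q : nat) : nat := (\sum_(p <= k < q) e k)%N.

Lemma cnt_cat e p q r : (p <= q)%N -> (q <= r)%N ->
  cnt e p r = (cnt e p q + cnt e q r)%N.
Proof. by move=> pq qr; rewrite /cnt (big_cat_nat pq qr). Qed.

Lemma cntS e i : cnt e 0 i.+1 = (cnt e 0 i + e i)%N.
Proof. by rewrite /cnt big_nat_recr. Qed.

Lemma cnt_le e p q : (cnt e p q <= q - p)%N.
Proof.
rewrite /cnt -[X in (_ <= X)%N]muln1 -sum_nat_const_nat.
by apply: leq_sum => i _; exact: leq_b1.
Qed.

Lemma iter_comm (Y : Type) (T S : Y -> Y) : T \o S = S \o T ->
  forall p q x, iter p T (iter q S x) = iter q S (iter p T x).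
Proof.
move=> TS; have h x : T (S x) = S (T x) by exact: (congr1 (fun h => h x) TS).
have h1 q x : T (iter q S x) = iter q S (T x).
  by elim: q => //= q IH; rewrite h IH.
by elim=> //= p IH q x; rewrite IH h1.
Qed.

(** The class [r] collects the [n] for which the exponents of [T] at lag [m] differ by [r]. The
    cutoff at [N] provides the finite support needed for the second van der Corput inequality. *)
Definition pair_weight (R : realType) (y : nat -> R) (e : nat -> bool)
  (N m r n : nat) : R :=
  if (n + m < N)%N && (cnt e n.+1 (n + m).+1 == r) then y n * y (n + m)%N else 0.

(** On the class [j] the lag-[i] integrals of the second step all coincide, so this numerical sum is
    their common coefficient. *)
Definition corr (R : realType) (y : nat -> R) (e : nat -> bool)
  (N m i r j : nat) : R :=
  \sum_(0 <= n < N) if cnt e n.+1 (n + i).+1 == j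
    then pair_weight y e N m r n * pair_weight y e N m r (n + i) else 0.

(* [M] and [M'] are the lengths of the two van der Corput windows, [l] and [l']
   the parameters of the two applications of the AM-GM inequality. *)
Definition inner_bound (R : realType) (y : nat -> R) (e : nat -> bool)
  (N M M' : nat) (l' : R) (m : nat) : R :=
  (N + M')%:R / M'%:R * (\sum_(0 <= n < N) y n ^+ 2 +
    2 * \sum_(1 <= i < M') (l' / 2 * M%:R * M'%:R +
      (2 * l')^-1 * \sum_(0 <= r < M) \sum_(0 <= j < M') corr y e N m i r j ^+ 2)).

Definition outer_bound (R : realType) (y : nat -> R) (e : nat -> bool)
  (N M M' : nat) (l l' : R) : R :=
  (N + M)%:R / M%:R * (\sum_(0 <= n < N) y n ^+ 2 +
    2 * \sum_(1 <= m < M) (l / 2 * M%:R +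
      (2 * l)^-1 * inner_bound y e N M M' l' m)).

(** The gap is [(2 * l)^-1 * (l - |q|)^2]. Here [p] will be the factor to be removed; the free
    parameter [l] is tuned later to the expected size of [q]. *)
Lemma norm_mul_le_amgm (R : realFieldType) (l p q : R) : 0 < l -> `|p| <= 1 ->
  `|p * q| <= l / 2 + (2 * l)^-1 * q ^+ 2.
Proof.
move=> l0 p1; rewrite normrM -(real_normK (num_real q)).
apply: le_trans (_ : `|q| <= _); first exact: ler_piMl.
rewrite -subr_ge0 [leRHS](_ : _ = (2 * l)^-1 * (l - `|q|) ^+ 2).
  by apply: mulr_ge0; [rewrite invr_ge0 mulr_ge0// ltW | exact: sqr_ge0].
by field; rewrite gt_eqF.
Qed.

Lemma sum_pick (V : nmodType) (F : nat -> V) (M k : nat) : (k < M)%N ->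
  \sum_(0 <= r < M) (if k == r then F r else 0) = F k.
Proof.
move=> kM; rewrite -big_mkcond/= (eq_bigl (pred1 k)); last by move=> i; rewrite eq_sym.
by rewrite big_nat1_eq kM.
Qed.

Lemma sum_pick_le (R : realFieldType) (F : nat -> R) (M k : nat) (C : R) : 0 <= C ->
  F k <= C -> \sum_(0 <= r < M) (if k == r then F r else 0) <= C.
Proof.
move=> C0 FC; have [kM|Mk] := ltnP k M; first by rewrite sum_pick.
rewrite big_nat big1// => i iM; case: eqP => // ki.
by move: iM; rewrite -ki ltnNge Mk.
Qed.

Section CommutingBound.
Context {d : measure_display} {Y : measurableType d} {R : realType}.
Variables (mu : probability Y R) (T S : Y -> Y).
Hypothesis mpT : measure_preserving mu T.
Hypothesis mpS : measure_preserving mu S.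
Hypothesis TS : T \o S = S \o T.
Variables (y : nat -> R) (e : nat -> bool).
Hypothesis y1 : forall n, `|y n| <= 1.

Lemma bmf_iter (U : Y -> Y) n u : measure_preserving mu U -> bmf u ->
  bmf (fun x => u (iter n U x) : R).
Proof. by move=> /(measure_preserving_iter n)[mU _]; exact: bmf_comp. Qed.

(** For a given [n] only one [r] contributes, so summing over the [M] classes costs no factor
    [M]. *)
Lemma sum_sqr_pair_weight N M m n :
  \sum_(0 <= r < M) pair_weight y e N m r n ^+ 2 <= y n ^+ 2.
Proof.
rewrite (eq_bigr (fun r => if cnt e n.+1 (n + m).+1 == r then
    (if (n + m < N)%N then (y n * y (n + m)%N) ^+ 2 else 0) else 0)); last first.
  by move=> r _; rewrite /pair_weight; case: (n + m < N)%N; case: (_ == r); rewrite //= expr0n.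
apply: sum_pick_le; first exact: sqr_ge0.
case: ifP => _; last exact: sqr_ge0.
by rewrite exprMn ler_piMr ?sqr_ge0// -real_normK ?num_real// expr_le1.
Qed.

Lemma pair_weight_ge N m r n : (N <= n)%N -> pair_weight y e N m r n = 0.
Proof.
by move=> Nn; rewrite /pair_weight ltnNge (leq_trans Nn) ?leq_addr.
Qed.

(** The part of the lag-[m] correlation that carries [G = g * (g \o S^m)], after composition with
    the power of [T] that brings the first exponent up to [cnt e 0 N]. Since counts increase, this
    power is nonnegative for [n < N]. *)
Definition twisted (G : Y -> R) N m r n (x : Y) : R :=
  pair_weight y e N m r n *
    G (iter (cnt e 0 N - cnt e 0 n.+1) T (iter n.+1 S x)).

Lemma bmf_twisted G N m r n : bmf G -> bmf (twisted G N m r n).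
Proof.
move=> bG; apply: bmfZ.
by apply: (@bmf_iter S n.+1 (fun x => G (iter _ T x))) => //; exact: bmf_iter.
Qed.

(** The two copies of [G] differ by [c] steps of [T] and [i] steps of [S]; the common factor
    [T^B S^(n+1)] disappears by invariance. The count [c] is at most [i < M'], so one of the listed
    classes [j] is hit. *)
Lemma mean_twisted2 G N M' m i r n : bmf G -> (i < M')%N ->
  \int[mu]_x (twisted G N m r n x * twisted G N m r (n + i) x) =
  \sum_(0 <= j < M') (if cnt e n.+1 (n + i).+1 == j then
     pair_weight y e N m r n * pair_weight y e N m r (n + i)%N *
     \int[mu]_x (G (iter j T x) * G (iter i S x)) else 0).
Proof.
move=> bG iM.
have kM : (cnt e n.+1 (n + i).+1 < M')%N.
  by apply: leq_ltn_trans (cnt_le _ _ _) _; rewrite subSS addKn.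
rewrite (sum_pick (fun j => pair_weight y e N m r n * pair_weight y e N m r (n + i)%N *
     \int[mu]_x (G (iter j T x) * G (iter i S x)))) //.
have [niN|Nni] := ltnP (n + i)%N N; last first.
  rewrite (pair_weight_ge _ _ Nni) mulr0 mul0r -[RHS](mean_cst mu).
  by apply: eq_Rintegral => x _; rewrite /twisted (pair_weight_ge _ _ Nni) mul0r mulr0.
set c := cnt e n.+1 _ in kM *.
set h := (fun x => G (iter c T x) * G (iter i S x)).
have bh : bmf h by apply: bmfM; exact: bmf_iter.
pose B := (cnt e 0 N - cnt e 0 (n + i).+1)%N.
rewrite -(mean_comp (measure_preserving_iter B mpT) bh).
have bhB : bmf (fun x => h (iter B T x)) by exact: bmf_iter.
rewrite -(mean_comp (measure_preserving_iter n.+1 mpS) bhB) -meanZ; last first.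
  by apply: (@bmf_iter S n.+1 (fun x => h (iter B T x))).
apply: eq_Rintegral => x _; rewrite /twisted /h.
rewrite [in X in _ = X](iter_comm TS) -!iterD.
have e1 : cnt e 0 (n + i).+1 = (cnt e 0 n.+1 + c)%N.
  by rewrite (cnt_cat e (leq0n n.+1)) ?ltnS ?leq_addr.
have e2 : (cnt e 0 (n + i).+1 <= cnt e 0 N)%N.
  by rewrite (cnt_cat e (leq0n (n + i).+1) niN) leq_addr.
have -> : (cnt e 0 N - cnt e 0 n.+1 = c + B)%N by rewrite /B; lia.
rewrite addnS [(i + n)%N]addnC -!(iter_comm TS B) -!iterD.
by rewrite -/B; ring.
Qed.

(** Van der Corput is applied for each [r], and AM-GM removes the integral of the two copies of [G],
    which is at most 1 in modulus. Summation over [r] multiplies only the AM-GM constant by [M]; the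
    diagonal terms are spread over disjoint classes. *)
Lemma mean_twisted_sum_le G N M M' m (l' : R) : (0 < M')%N -> 0 < l' ->
  bmf G -> (forall x, `|G x| <= 1) ->
  \sum_(0 <= r < M) \int[mu]_x ((\sum_(0 <= n < N) twisted G N m r n x) ^+ 2) <=
  inner_bound y e N M M' l' m.
Proof.
move=> M0 l0 bG G1.
have H r : \int[mu]_x ((\sum_(0 <= n < N) twisted G N m r n x) ^+ 2) <=
    (N + M')%:R / M'%:R * (\sum_(0 <= n < N) pair_weight y e N m r n ^+ 2 +
    2 * \sum_(1 <= i < M') (l' / 2 * M'%:R +
      (2 * l')^-1 * \sum_(0 <= j < M') corr y e N m i r j ^+ 2)).
  have bt n : bmf (twisted G N m r n) by exact: bmf_twisted.
  apply: (le_trans (van_der_corput_mean mu M0 bt _)).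
    by move=> n x Nn; rewrite /twisted pair_weight_ge ?mul0r.
  rewrite ler_wpM2l ?divr_ge0//; apply: lerD.
    apply: ler_sum_nat => n _; apply: mean_le_cst => [|x]; first exact: bmf_sqr.
    rewrite exprMn ler_piMr ?sqr_ge0// -real_normK ?num_real// expr_le1//.
  rewrite ler_wpM2l//; apply: ler_sum_nat => i /andP[i1 iM].
  under eq_bigr do rewrite (mean_twisted2 _ _ _ _ bG iM).
  rewrite exchange_big_nat/=.
  apply: (@le_trans _ _ (\sum_(0 <= j < M') (l' / 2 +
      (2 * l')^-1 * corr y e N m i r j ^+ 2))); last first.
    by rewrite big_split/= sumr_const_nat subn0 -[_ *+ M']mulr_natr mulr_sumr.
  apply: (le_trans (ler_norm_sum _ _ _)); apply: ler_sum_nat => j _.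
  have -> : \sum_(0 <= n < N) (if cnt e n.+1 (n + i).+1 == j then
     pair_weight y e N m r n * pair_weight y e N m r (n + i)%N *
     \int[mu]_x (G (iter j T x) * G (iter i S x)) else 0) =
     \int[mu]_x (G (iter j T x) * G (iter i S x)) * corr y e N m i r j.
    rewrite mulr_sumr; apply: eq_bigr => n _; case: ifP => _; last by rewrite mulr0.
    by rewrite mulrC.
  apply: norm_mul_le_amgm => //; apply: mean_norm_le => [|x].
    by apply: bmfM; exact: bmf_iter.
  by rewrite normrM mulr_ile1.
apply: (le_trans (ler_sum_nat (fun r _ => H r))).
rewrite -mulr_sumr ler_wpM2l ?divr_ge0// big_split/=; apply: lerD.
  by rewrite exchange_big_nat/=; apply: ler_sum_nat => n _; exact: sum_sqr_pair_weight.
rewrite -mulr_sumr ler_wpM2l// exchange_big_nat/=; apply: ler_sum_nat => i _.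
rewrite big_split/= sumr_const_nat subn0 -mulr_sumr -[_ *+ M]mulr_natr.
by rewrite -!mulrA [M'%:R * _]mulrC.
Qed.

(** The right side sees only [y] and [e]. This is what lets one set of good omega serve all systems
    at once. *)
Lemma mean_commuting_sum_le (f g : Y -> R) N M M' (l l' : R) :
  (0 < M)%N -> (0 < M')%N -> 0 < l -> 0 < l' ->
  bmf f -> bmf g -> (forall x, `|f x| <= 1) -> (forall x, `|g x| <= 1) ->
  \int[mu]_x ((\sum_(0 <= n < N)
     y n * (f (iter (cnt e 0 n.+1) T x) * g (iter n.+1 S x))) ^+ 2) <=
  outer_bound y e N M M' l l'.
Proof.
move=> M0 M'0 l0 l'0 bf bg f1 g1.
pose v n x := if (n < N)%N then y n * (f (iter (cnt e 0 n.+1) T x) * g (iter n.+1 S x)) else 0.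
have bv n : bmf (v n).
  rewrite /v; case: (n < N)%N; last exact: bmf_cst.
  by apply: bmfZ; apply: bmfM; exact: bmf_iter.
have -> : (fun x => (\sum_(0 <= n < N)
     y n * (f (iter (cnt e 0 n.+1) T x) * g (iter n.+1 S x))) ^+ 2) =
     (fun x => (\sum_(0 <= n < N) v n x) ^+ 2).
  apply/funext => x; congr (_ ^+ 2); apply: eq_big_nat => n /andP[_ nN].
  by rewrite /v nN.
apply: (le_trans (van_der_corput_mean mu M0 bv _)).
  by move=> n x Nn; rewrite /v ltnNge Nn.
rewrite ler_wpM2l ?divr_ge0//; apply: lerD.
  apply: ler_sum_nat => n /andP[_ nN].
  apply: mean_le_cst => [|x]; first exact: bmf_sqr.
  rewrite /v nN exprMn ler_piMr ?sqr_ge0// -real_normK ?num_real// expr_le1//.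
  by rewrite normrM mulr_ile1.
rewrite ler_wpM2l//; apply: ler_sum_nat => m /andP[m1 mM].
pose G x := g x * g (iter m S x).
have bG : bmf G by apply: bmfM => //; exact: bmf_iter.
have G1 x : `|G x| <= 1 by rewrite normrM mulr_ile1.
pose F r x := f (iter (cnt e 0 N) T x) * f (iter (cnt e 0 N + r) T x).
have bF r : bmf (F r) by apply: bmfM; exact: bmf_iter.
have F1 r x : `|F r x| <= 1 by rewrite normrM mulr_ile1.
pose V r x := \sum_(0 <= n < N) twisted G N m r n x.
have bV r : bmf (V r) by apply: bmf_sum => n _; exact: bmf_twisted.
have bFt r n : bmf (fun x => F r x * twisted G N m r n x).
  by apply: bmfM => //; exact: bmf_twisted.
(* Composition with [T^B], where [B] is the number of selected times left before [N], turns the two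
   values of [f] into [F r] with [r] the count over the lag. Hence [F r] leaves the sum over [n]. *)
have key n : (n < N)%N -> \int[mu]_x (v n x * v (n + m)%N x) =
    \sum_(0 <= r < M) \int[mu]_x (F r x * twisted G N m r n x).
  move=> nN; rewrite -mean_sum; last by move=> r _.
  have -> : (fun x => \sum_(0 <= r < M) F r x * twisted G N m r n x) =
     fun x => if (n + m < N)%N then y n * y (n + m)%N *
       (F (cnt e n.+1 (n + m).+1) x *
        G (iter (cnt e 0 N - cnt e 0 n.+1) T (iter n.+1 S x))) else 0.
    apply/funext => x; have kM : (cnt e n.+1 (n + m).+1 < M)%N.
      by apply: leq_ltn_trans (cnt_le _ _ _) _; rewrite subSS addKn.
    rewrite -(@sum_pick _ (fun r => if (n + m < N)%N then y n * y (n + m)%N *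
       (F r x * G (iter (cnt e 0 N - cnt e 0 n.+1) T (iter n.+1 S x))) else 0) M) //.
    apply: eq_bigr => r _; rewrite /twisted /pair_weight.
    by case: (_ == r); case: (n + m < N)%N; rewrite /= ?mul0r ?mulr0//; ring.
  have [nmN|Nnm] := ltnP (n + m)%N N; last first.
    by apply: eq_Rintegral => x _; rewrite /v [(n + m < N)%N]ltnNge Nnm mulr0.
  set B := (cnt e 0 N - cnt e 0 n.+1)%N.
  have bvv : bmf (fun x => v n x * v (n + m)%N x) by exact: bmfM.
  rewrite -(mean_comp (measure_preserving_iter B mpT) bvv).
  apply: eq_Rintegral => x _; rewrite /v nN nmN /F /G -!iterD.
  have e1 : cnt e 0 (n + m).+1 = (cnt e 0 n.+1 + cnt e n.+1 (n + m).+1)%N.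
    by rewrite (cnt_cat e (leq0n n.+1)) ?ltnS ?leq_addr.
  have e2 : (cnt e 0 n.+1 <= cnt e 0 N)%N.
    by rewrite (cnt_cat e (leq0n n.+1) nN) leq_addr.
  rewrite (_ : cnt e 0 n.+1 + B = cnt e 0 N)%N; last by rewrite /B; lia.
  rewrite (_ : cnt e 0 (n + m).+1 + B = cnt e 0 N + cnt e n.+1 (n + m).+1)%N; last first.
    by rewrite /B; lia.
  rewrite -!(iter_comm TS B) -iterD addnS [(m + n)%N]addnC; ring.
have -> : \sum_(0 <= n < N) \int[mu]_x (v n x * v (n + m)%N x) =
    \sum_(0 <= r < M) \int[mu]_x (F r x * V r x).
  rewrite (eq_big_nat _ _ (F2 := fun n => \sum_(0 <= r < M) \int[mu]_x (F r x * twisted G N m r n x))); last first.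
    by move=> n /andP[_ nN]; exact: key.
  rewrite exchange_big_nat/=; apply: eq_bigr => r _.
  rewrite -mean_sum; last by move=> n _.
  by apply: eq_Rintegral => x _; rewrite mulr_sumr.
apply: (le_trans (ler_norm_sum _ _ _)).
(* AM-GM holds pointwise with [|F r x| <= 1]; this eliminates [f] and leaves the second moment of
   [V r]. *)
apply: (@le_trans _ _ (\sum_(0 <= r < M) (l / 2 + (2 * l)^-1 * \int[mu]_x (V r x ^+ 2)))).
  apply: ler_sum_nat => r _.
  apply: (@le_trans _ _ (\int[mu]_x (`|F r x * V r x|))).
    by apply: le_normr_Rintegral => //; apply: bmf_integrable; exact: bmfM.
  rewrite -meanZ; last exact: bmf_sqr.
  rewrite -[l / 2](mean_cst mu) -meanD; last by apply/bmfZ/bmf_sqr.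
    apply: le_mean => [||x]; [by apply/bmf_norm/bmfM| |exact: norm_mul_le_amgm].
    by apply: bmfD; [exact: bmf_cst | apply/bmfZ/bmf_sqr].
  exact: bmf_cst.
rewrite big_split/= sumr_const_nat subn0 -mulr_sumr -[_ *+ M]mulr_natr lerD2l.
by rewrite ler_wpM2l ?invr_ge0 ?mulr_ge0 ?(ltW l0)//; exact: mean_twisted_sum_le.
Qed.

End CommutingBound.

(** * Orthogonality of centered Bernoulli products *)

(** Dependence on finitely many coordinates as a property of the function on sequences: both
    measurability and independence then follow by induction on the list, one coordinate at a
    time. *)
Definition depends_on (A : Type) (J : seq nat) (phi : (nat -> bool) -> A) : Prop :=
  forall e e' : nat -> bool, {in J, e =1 e'} -> phi e = phi e'.

Definition update (e : nat -> bool) (j : nat) (b : bool) : nat -> bool :=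
  fun i => if i == j then b else e i.

Lemma depends_on_update (A : Type) (j : nat) (J : seq nat) b (phi : (nat -> bool) -> A) :
  depends_on (j :: J) phi -> depends_on J (fun e => phi (update e j b)).
Proof.
move=> hphi e e' ee'; apply: hphi => i; rewrite inE /update.
by case: eqP => //= _; exact: ee'.
Qed.

Lemma update_id e j : update e j (e j) = e.
Proof. by apply/funext => i; rewrite /update; case: eqP => [->|]. Qed.

Section Bernoulli.
Context {d : measure_display} {Omega : measurableType d} {R : realType}.
Variables (P : probability Omega R) (e : Omega -> nat -> bool) (p : nat -> R).
Hypothesis bmf_e : forall n, bmf (fun w => (e w n)%:R : R).
Hypothesis p01 : forall n, 0 <= p n <= 1.
Hypothesis indep_e : forall (L : seq nat) (v : nat -> bool), uniq L ->
  \int[P]_w (all (fun i => e w i == v i) L)%:R =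
  \prod_(i <- L) (if v i then p i else 1 - p i).

Lemma split_coord (phi : (nat -> bool) -> R) j w :
  phi (e w) = (e w j == true)%:R * phi (update (e w) j true) +
              (e w j == false)%:R * phi (update (e w) j false).
Proof.
by rewrite -{1}(update_id (e w) j); case: (e w j); rewrite ?(mul0r, mul1r) ?(addr0, add0r).
Qed.

Lemma bmf_coord n b : bmf (fun w => (e w n == b)%:R : R).
Proof.
case: b; first by under eq_fun do rewrite eqb_id; exact: bmf_e.
rewrite (_ : (fun _ => _) = fun w => 1 - (e w n)%:R); last first.
  by apply/funext => w; case: (e w n); rewrite ?subrr ?subr0.
by apply: bmfB => //; exact: bmf_cst.
Qed.

Lemma bmf_all (L : seq nat) (v : nat -> bool) :
  bmf (fun w => (all (fun i => e w i == v i) L)%:R : R).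
Proof.
elim: L => [|j L IH] /=; first exact: bmf_cst.
rewrite (_ : (fun _ => _) = fun w => (e w j == v j)%:R *
  (all (fun i => e w i == v i) L)%:R); first by apply: bmfM => //; exact: bmf_coord.
by apply/funext => w; case: (_ == _); rewrite ?mul1r ?mul0r.
Qed.

Lemma bmf_depends (J : seq nat) (phi : (nat -> bool) -> R) :
  depends_on J phi -> bmf (fun w => phi (e w)).
Proof.
elim: J phi => [|j J IH] phi hphi.
  rewrite (_ : (fun _ => _) = fun=> phi xpred0); first exact: bmf_cst.
  by apply/funext => w; exact: hphi.
rewrite (funext (split_coord phi j)); apply: bmfD; apply: bmfM;
  (exact: bmf_coord || exact: IH (depends_on_update _ hphi)).
Qed.

Definition centered (f : nat -> bool) (n : nat) : R := (f n)%:R - p n.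

Lemma norm_centered f n : `|centered f n| <= 1.
Proof.
have /andP[p0 p1] := p01 n; rewrite /centered ler_norml.
by case: (f n) => /=; apply/andP; split; lra.
Qed.

Lemma bmf_centered n : bmf (fun w => centered (e w) n).
Proof. by apply: bmfB => //; exact: bmf_cst. Qed.

(** Induction moves one coordinate after another from [J] into the cylinder over [L], splitting
    [phi] according to its value there. Once [phi] is constant, adjoining [n] to the cylinder
    multiplies its probability by [p n], and the two terms cancel. *)
Lemma mean_centered_all n (J L : seq nat) (v : nat -> bool)
  (phi : (nat -> bool) -> R) : uniq (n :: J ++ L) -> depends_on J phi ->
  \int[P]_w (centered (e w) n * ((all (fun i => e w i == v i) L)%:R * phi (e w))) = 0.
Proof.
elim: J L v phi => [|j J IH] L v phi /=.
  move=> /andP[nL uL] hphi; pose c := phi xpred0.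
  have nv i : i \in L -> update v n true i = v i.
    by move=> iL; rewrite /update; case: eqP => // ni; rewrite -ni iL in nL.
  have aE w : all (fun i => e w i == update v n true i) (n :: L) =
      e w n && all (fun i => e w i == v i) L.
    rewrite /= {1}/update eqxx eqb_id; congr (_ && _).
    by apply: eq_in_all => i iL; rewrite nv.
  rewrite (_ : (fun _ => _) = fun w => c *
     ((all (fun i => e w i == update v n true i) (n :: L))%:R -
      p n * (all (fun i => e w i == v i) L)%:R)); last first.
    apply/funext => w; rewrite aE /centered (hphi (e w) xpred0)// -/c.
    by case: (e w n); case: (all _ L) => /=; ring.
  have b1 := bmf_all (n :: L) (update v n true).
  have b2 : bmf (fun w => p n * (all (fun i => e w i == v i) L)%:R) by apply/bmfZ/bmf_all.
  rewrite meanZ; last exact: bmfB.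
  rewrite meanB// meanZ; last exact: bmf_all.
  rewrite !indep_e//=; last by rewrite nL.
  rewrite big_cons {1}/update eqxx (eq_big_seq (fun i => if v i then p i else 1 - p i)).
    by rewrite subrr mulr0.
  by move=> i iL; rewrite nv.
move=> /and3P[nJ jJ uJ] hphi.
move: nJ jJ; rewrite inE mem_cat mem_cat !negb_or => /and3P[nj nJ nL] /andP[jJ jL].
have step b : \int[P]_w (centered (e w) n *
    ((all (fun i => e w i == update v j b i) (j :: L))%:R * phi (update (e w) j b))) = 0.
  apply: IH (depends_on_update _ hphi).
  by rewrite /= -cat1s uniq_catCA /= mem_cat !inE !mem_cat (negbTE nj) (negbTE nJ)
    (negbTE nL) (negbTE jJ) (negbTE jL).
have aE b w : all (fun i => e w i == update v j b i) (j :: L) =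
    (e w j == b) && all (fun i => e w i == v i) L.
  rewrite /= {1}/update eqxx; congr (_ && _).
  apply: eq_in_all => i iL; rewrite /update ifN//.
  by apply: contraNneq jL => <-.
have bb b : bmf (fun w => centered (e w) n *
    ((all (fun i => e w i == update v j b i) (j :: L))%:R * phi (update (e w) j b))).
  apply: bmfM (bmf_centered n) _; apply: bmfM (bmf_all _ _) _.
  exact: bmf_depends (depends_on_update _ hphi).
rewrite -[RHS]addr0 -{1}(step true) -(step false) -meanD//.
apply: eq_Rintegral => w _; rewrite !aE (split_coord phi j w).
by case: (e w j); case: (all _ L) => /=; ring.
Qed.

Lemma mean_centered n (J : seq nat) (phi : (nat -> bool) -> R) :
  uniq (n :: J) -> depends_on J phi ->
  \int[P]_w (centered (e w) n * phi (e w)) = 0.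
Proof.
move=> uJ hphi; rewrite -[RHS](@mean_centered_all n J [::] xpred0 phi) ?cats0//.
by apply: eq_Rintegral => w _ /=; rewrite mul1r.
Qed.

Lemma mean_sqr_centered n : \int[P]_w (centered (e w) n ^+ 2) <= p n.
Proof.
have h0 : \int[P]_w centered (e w) n = 0.
  rewrite -[RHS](@mean_centered n [::] (fun=> 1))//.
  by apply: eq_Rintegral => w _; rewrite mulr1.
(* As [e w n] takes only the values 0 and 1, the square is an affine function of the centered
   variable. *)
have -> : \int[P]_w (centered (e w) n ^+ 2) =
    \int[P]_w ((1 - 2 * p n) * centered (e w) n + p n * (1 - p n)).
  by apply: eq_Rintegral => w _; rewrite /centered; case: (e w n) => /=; ring.
rewrite meanD; [|by apply: bmfZ; exact: bmf_centered|exact: bmf_cst].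
rewrite (meanZ _ _ (bmf_centered n)).
rewrite h0 mulr0 add0r mean_cst.
have /andP[p0 p1] := p01 n; nra.
Qed.

(** For [q < n] the variable at [q] is the earliest in the cross term and everything else depends on
    later coordinates, so the cross term has mean 0. The condition on the squares lets the whole
    family indexed by [r] be estimated for the price of one sum. *)
Lemma second_moment (I : Type) (r : seq I) (phi : I -> nat -> (nat -> bool) -> R) N K :
  (N <= K)%N ->
  (forall k n, (n < N)%N -> depends_on (index_iota n.+1 K) (phi k n)) ->
  (forall n f, \sum_(k <- r) phi k n f ^+ 2 <= 1) ->
  \sum_(k <- r) \int[P]_w ((\sum_(0 <= n < N) centered (e w) n * phi k n (e w)) ^+ 2) <=
  \sum_(0 <= n < N) p n.
Proof.
move=> NK hphi phi1.
pose psi k n w := if (n < N)%N then phi k n (e w) else 0.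
have bpsi k n : bmf (psi k n).
  rewrite /psi; case: (ltnP n N) => nN; last exact: bmf_cst.
  exact: bmf_depends (hphi k n nN).
have bx k n : bmf (fun w => centered (e w) n * psi k n w).
  by apply: bmfM => //; exact: bmf_centered.
have E k : \int[P]_w ((\sum_(0 <= n < N) centered (e w) n * phi k n (e w)) ^+ 2) =
    \sum_(0 <= n < N) \int[P]_w ((centered (e w) n * psi k n w) ^+ 2).
  rewrite -mean_sum; last by move=> n _; exact: bmf_sqr.
  pose B w := \sum_(0 <= n < N) \sum_(0 <= q < n)
      (centered (e w) n * psi k n w) * (centered (e w) q * psi k q w).
  pose A w := \sum_(0 <= n < N) (centered (e w) n * psi k n w) ^+ 2.
  have bB : bmf B by apply: bmf_sum => n _; apply: bmf_sum => q _; exact: bmfM.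
  have bA : bmf A by apply: bmf_sum => n _; exact: bmf_sqr.
  transitivity (\int[P]_w (A w + 2 * B w)).
    apply: eq_Rintegral => w _; rewrite -sqr_sum_expand; congr (_ ^+ 2).
    by apply: eq_big_nat => n /andP[_ nN]; rewrite /psi nN.
  rewrite (meanD _ bA (bmfZ 2 bB)) (meanZ _ _ bB).
  suff -> : \int[P]_w B w = 0 by rewrite mulr0 addr0.
  rewrite mean_sum; last by move=> n _; apply: bmf_sum => q _; exact: bmfM.
  rewrite big_nat big1// => n /andP[_ nN].
  rewrite mean_sum; last by move=> q _; exact: bmfM.
  rewrite big_nat big1// => q /andP[_ qn].
  rewrite -[RHS](@mean_centered q (index_iota q.+1 K)
    (fun f => phi k q f * (centered f n * phi k n f))).
  - by apply: eq_Rintegral => w _; rewrite /psi nN (ltn_trans qn nN); ring.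
  - by rewrite /= mem_index_iota ltnn iota_uniq.
  - move=> f f' ff'; congr (_ * (_ * _)).
    + by apply: hphi ff'; exact: ltn_trans nN.
    + by rewrite /centered ff'// mem_index_iota qn (leq_trans nN).
    + apply: hphi => // i; rewrite mem_index_iota => /andP[ni iK].
      by rewrite ff'// mem_index_iota iK (leq_trans _ ni)// ltnS ltnW.
under eq_bigr do rewrite E.
rewrite exchange_big/= big_nat [leRHS]big_nat; apply: ler_sum => n /andP[_ nN].
rewrite -mean_sum; last by move=> k _; exact: bmf_sqr.
apply: le_trans (mean_sqr_centered n); apply: le_mean.
- by apply: bmf_sum => k _; exact: bmf_sqr.
- by apply/bmf_sqr/bmf_centered.
- move=> w; under eq_bigr do rewrite exprMn /psi nN.
  by rewrite -mulr_sumr ler_piMr ?sqr_ge0.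
Qed.

(** The summand of [corr] without its factor at [n]. Isolating the earliest variable avoids a case
    distinction: even when [m = i] makes later indices coincide, the factor at [n] occurs once. *)
Definition corr_weight N m i r j n (f : nat -> bool) : R :=
  if (cnt f n.+1 (n + i).+1 == j) &&
     ((n + m < N)%N && (cnt f n.+1 (n + m).+1 == r)) then
    centered f (n + m) * pair_weight (centered f) f N m r (n + i) else 0.

Lemma corr_centered f N m i r j : corr (centered f) f N m i r j =
  \sum_(0 <= n < N) centered f n * corr_weight N m i r j n f.
Proof.
apply: eq_bigr => n _; rewrite /corr_weight {1}/pair_weight.
by do 2 case: (_ == _); case: (n + m < N)%N; rewrite /= ?mulr0 ?mul0r ?mulrA.
Qed.

Lemma eq_cnt (f f' : nat -> bool) q s :
  (forall i, (q <= i < s)%N -> f i = f' i) -> cnt f q s = cnt f' q s.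
Proof. by move=> ff'; apply: eq_big_nat => i /ff' ->. Qed.

(** Positivity of [m] and [i] keeps coordinate [n] itself out. The range ends at [N + i] rather than
    [N] because the count that selects the class [j] reads up to [n + i]. *)
Lemma depends_corr_weight N m i r j n : (0 < m)%N -> (0 < i)%N -> (n < N)%N ->
  depends_on (index_iota n.+1 (N + i)) (corr_weight N m i r j n).
Proof.
move=> m0 i0 nN f f' ff'.
have h k : (n < k)%N -> (k < N + i)%N -> f k = f' k.
  by move=> nk kN; rewrite ff'// mem_index_iota nk.
have c1 : cnt f n.+1 (n + i).+1 = cnt f' n.+1 (n + i).+1.
  by apply: eq_cnt => k /andP[nk ki]; apply: h => //; lia.
rewrite /corr_weight c1; case: ifP => [|]; last first.
  case: (ltnP (n + m) N) => nm; last by rewrite !andbF.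
  rewrite (@eq_cnt f f') => [-> //|k /andP[nk ki]]; apply: h => //; lia.
move=> /and3P[cj nm /eqP <-]; rewrite nm cj.
rewrite -(@eq_cnt f f' n.+1 (n + m).+1) => [|k /andP[nk ki]]; last by apply: h => //; lia.
rewrite eqxx /=.
congr (_ * _); first by rewrite /centered h//; lia.
rewrite /pair_weight; case: (ltnP (n + i + m) N) => //= nim.
rewrite (@eq_cnt f f' (n + i).+1) => [|k /andP[nk ki]]; last by apply: h => //; lia.
by case: ifP => // _; rewrite /centered !h//; lia.
Qed.

Lemma sum_sqr_corr_weight N M M' m i n f :
  \sum_(0 <= r < M) \sum_(0 <= j < M') corr_weight N m i r j n f ^+ 2 <= 1.
Proof.
apply: (@le_trans _ _ (\sum_(0 <= r < M)
    (if cnt f n.+1 (n + m).+1 == r then 1 else 0))); last exact: sum_pick_le.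
apply: ler_sum_nat => r _.
case: eqP => [Er|nEr]; last first.
  rewrite big1// => j _; rewrite /corr_weight; case: ifP; last by rewrite expr0n.
  by move=> /and3P[_ _ /eqP].
apply: (@le_trans _ _ (\sum_(0 <= j < M')
    (if cnt f n.+1 (n + i).+1 == j then 1 else 0))); last exact: sum_pick_le.
apply: ler_sum_nat => j _; rewrite /corr_weight.
case: (_ == j) => /=; last by rewrite expr0n.
case: ifP => _; last by rewrite expr0n.
rewrite -real_normK ?num_real// expr_le1// normrM mulr_ile1 ?norm_centered//.
rewrite /pair_weight; case: ifP => _; last by rewrite normr0.
by rewrite normrM mulr_ile1 ?norm_centered.
Qed.

Lemma bmf_corr N m i r j : (0 < m)%N -> (0 < i)%N ->
  bmf (fun w => corr (centered (e w)) (e w) N m i r j).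
Proof.
move=> m0 i0; under eq_fun do rewrite corr_centered big_nat.
apply: bmf_sum => n /andP[_ nN]; apply: bmfM (bmf_centered n) _.
exact: bmf_depends (depends_corr_weight r j m0 i0 nN).
Qed.

(** Orthogonality is applied to all pairs [(r, j)] simultaneously. For fixed [n] a single pair is
    active, so no factor [M * M'] appears; the balance behind 1/14 depends on this. *)
Lemma sum_mean_sqr_corr_le N M M' m i : (0 < m)%N -> (0 < i)%N ->
  \sum_(0 <= r < M) \sum_(0 <= j < M')
    \int[P]_w (corr (centered (e w)) (e w) N m i r j ^+ 2) <=
  \sum_(0 <= n < N) p n.
Proof.
move=> m0 i0.
apply: (@le_trans _ _ (\sum_(k <- [seq (r, j) | r <- index_iota 0 M, j <- index_iota 0 M'])
    \int[P]_w ((\sum_(0 <= n < N) centered (e w) n * corr_weight N m i k.1 k.2 n (e w)) ^+ 2))).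
  rewrite big_allpairs/=; apply: ler_sum => r _; apply: ler_sum => j _.
  rewrite le_eqVlt; apply/orP; left; apply/eqP; apply: eq_Rintegral => w _.
  by rewrite corr_centered.
apply: (@second_moment _ _ (fun k => corr_weight N m i k.1 k.2) N (N + i)).
- by rewrite leq_addr.
- by move=> k n nN; exact: depends_corr_weight.
- by move=> n f; rewrite big_allpairs; exact: sum_sqr_corr_weight.
Qed.

End Bernoulli.

Ltac nonneg := repeat first [done | assumption | (apply: ltW; assumption)
  | exact: ler0n | exact: sqr_ge0 | apply: mulr_ge0 | apply: addr_ge0
  | rewrite invr_ge0 | apply: exprn_ge0].

Lemma bmf_sum_nat d (Y : measurableType d) (R : realType) m n (F : nat -> Y -> R) :
  (forall i, (m <= i < n)%N -> bmf (F i)) -> bmf (fun x => \sum_(m <= i < n) F i x).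
Proof.
move=> hF; rewrite (_ : (fun _ => _) = fun x => \sum_(m <= i < n | (m <= i < n)%N) F i x).
  exact: bmf_sum.
by apply/funext => x; rewrite big_nat.
Qed.

Lemma mean_sum_nat d (Y : measurableType d) (R : realType) (mu : probability Y R)
  m n (F : nat -> Y -> R) : (forall i, (m <= i < n)%N -> bmf (F i)) ->
  \int[mu]_x (\sum_(m <= i < n) F i x) = \sum_(m <= i < n) \int[mu]_x F i x.
Proof.
move=> hF; rewrite [RHS]big_nat -mean_sum//.
by apply: eq_Rintegral => x _; rewrite big_nat.
Qed.

(** By monotone convergence the series has finite integral, hence is finite almost everywhere. *)
Lemma ae_bounded_partial_sums d (Y : measurableType d) (R : realType)
  (mu : probability Y R) (u : nat -> Y -> R) (C : R) :
  (forall k, bmf (u k)) -> (forall k x, 0 <= u k x) ->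
  (forall n, \sum_(0 <= k < n) \int[mu]_x u k x <= C) ->
  {ae mu, forall x, exists D : R, forall n, \sum_(0 <= k < n) u k x <= D}.
Proof.
move=> bu u0 hC; pose F x := (\sum_(0 <= k <oo) (u k x)%:E)%E.
have mu_ k : measurable_fun setT (fun x => (u k x)%:E).
  by apply: measurableT_comp => //; case: (bu k).
have F0 x : (0 <= F x)%E by apply: nneseries_ge0 => k _ _; rewrite lee_fin.
have iF : (\int[mu]_x F x <= C%:E)%E.
  rewrite integral_nneseries//; last by move=> k x _; rewrite lee_fin.
  apply: lime_le.
    by apply: is_cvg_nneseries => k _ _; apply: integral_ge0 => x _; rewrite lee_fin.
  apply: nearW => n; rewrite (eq_bigr (fun k => (\int[mu]_x u k x)%:E)) => [|k _].
    by rewrite sumEFin lee_fin.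
  by rewrite fineK//; apply: integrable_fin_num => //; exact: bmf_integrable.
have intF : mu.-integrable setT F.
  apply/integrableP; split.
    by apply: ge0_emeasurable_sum => // k x _ _; rewrite lee_fin.
  rewrite (eq_integral F); first by rewrite (le_lt_trans iF)// ltry.
  by move=> x _; rewrite gee0_abs.
have := integrable_ae measurableT intF.
apply: filterS => x /(_ Logic.I) Fx; exists (fine (F x)) => n.
rewrite -lee_fin fineK// -sumEFin.
by apply: nneseries_lim_ge => k _ _; rewrite lee_fin.
Qed.

(** * Expectation of the uniform bound *)

Section BernoulliBound.
Context {d : measure_display} {Omega : measurableType d} {R : realType}.
Variables (P : probability Omega R) (e : Omega -> nat -> bool) (p : nat -> R).
Hypothesis bmf_e : forall n, bmf (fun w => (e w n)%:R : R).
Hypothesis p01 : forall n, 0 <= p n <= 1.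
Hypothesis indep_e : forall (L : seq nat) (v : nat -> bool), uniq L ->
  \int[P]_w (all (fun i => e w i == v i) L)%:R =
  \prod_(i <- L) (if v i then p i else 1 - p i).

Let y w := centered p (e w).

Lemma bmf_sum_sqr_centered N : bmf (fun w => \sum_(0 <= n < N) y w n ^+ 2).
Proof. by apply: bmf_sum => n _; apply/bmf_sqr/bmf_centered. Qed.

Lemma mean_sum_sqr_centered_le N :
  \int[P]_w (\sum_(0 <= n < N) y w n ^+ 2) <= \sum_(0 <= n < N) p n.
Proof.
rewrite mean_sum; last by move=> n _; apply/bmf_sqr/bmf_centered.
by apply: ler_sum => n _; exact: mean_sqr_centered.
Qed.

(** The common shape of [inner_bound] and [outer_bound]: a window factor times a diagonal plus twice
    a sum over lags. *)
Lemma mean_affine_sum_le (K : nat) (A a b : R) (s : Omega -> R) (t : nat -> Omega -> R) :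
  0 <= A -> 0 <= b -> bmf s -> \int[P]_w s w <= a ->
  (forall i, (1 <= i < K)%N -> bmf (t i) /\ \int[P]_w t i w <= b) ->
  bmf (fun w => A * (s w + 2 * \sum_(1 <= i < K) t i w)) /\
  \int[P]_w (A * (s w + 2 * \sum_(1 <= i < K) t i w)) <= A * (a + K%:R * (2 * b)).
Proof.
move=> A0 b0 bs sa ht.
have bt : bmf (fun w => \sum_(1 <= i < K) t i w).
  by apply: bmf_sum_nat => i /ht[].
have b2 : bmf (fun w => s w + 2 * \sum_(1 <= i < K) t i w).
  by apply: bmfD => //; exact: bmfZ.
split; first exact: bmfZ.
rewrite (meanZ _ _ b2) ler_wpM2l// (meanD _ bs (bmfZ 2 bt)) (meanZ _ _ bt) lerD//.
rewrite [leRHS]mulrCA ler_wpM2l// mean_sum_nat => [|i /ht[]//].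
apply: (@le_trans _ _ (\sum_(1 <= i < K) b)).
  by apply: ler_sum_nat => i /ht[].
by rewrite sumr_const_nat -[_ *+ _]mulr_natl ler_wpM2r// ler_nat leq_subr.
Qed.

Definition inner_mean_bound N M M' (l' : R) : R :=
  (N + M')%:R / M'%:R * (\sum_(0 <= n < N) p n + M'%:R * (2 *
    (l' / 2 * M%:R * M'%:R + (2 * l')^-1 * \sum_(0 <= n < N) p n))).

Definition outer_mean_bound N M M' (l l' : R) : R :=
  (N + M)%:R / M%:R * (\sum_(0 <= n < N) p n + M%:R * (2 *
    (l / 2 * M%:R + (2 * l)^-1 * inner_mean_bound N M M' l'))).

Lemma mean_inner_bound_le N M M' (l' : R) m : 0 < l' -> (0 < m)%N ->
  bmf (fun w => inner_bound (y w) (e w) N M M' l' m) /\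
  \int[P]_w inner_bound (y w) (e w) N M M' l' m <= inner_mean_bound N M M' l'.
Proof.
move=> l0 m0; have W0 : 0 <= \sum_(0 <= n < N) p n.
  by apply: sumr_ge0 => n _; case/andP: (p01 n).
have c0 : 0 <= l' / 2 * M%:R * M'%:R by nonneg.
have i0 : 0 <= (2 * l')^-1 by rewrite invr_ge0 mulr_ge0// ltW.
apply: mean_affine_sum_le.
- by nonneg.
- by nonneg.
- exact: bmf_sum_sqr_centered.
- exact: mean_sum_sqr_centered_le.
move=> i /andP[i1 _].
have bc r j : bmf (fun w => corr (y w) (e w) N m i r j ^+ 2).
  by apply/bmf_sqr/bmf_corr.
have bcs : bmf (fun w => \sum_(0 <= r < M) \sum_(0 <= j < M') corr (y w) (e w) N m i r j ^+ 2).
  by do 2 (apply: bmf_sum => ? _); exact: bc.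
split; first by apply: bmfD; [exact: bmf_cst | exact: bmfZ].
rewrite (meanD _ (bmf_cst _) (bmfZ _ bcs)) mean_cst lerD2l (meanZ _ _ bcs) ler_wpM2l//.
rewrite mean_sum; last by move=> r _; apply: bmf_sum => j _; exact: bc.
rewrite (eq_bigr (fun r => \sum_(0 <= j < M') \int[P]_w (corr (y w) (e w) N m i r j ^+ 2))).
  exact: sum_mean_sqr_corr_le.
by move=> r _; rewrite mean_sum.
Qed.

Lemma mean_outer_bound_le N M M' (l l' : R) : 0 < l -> 0 < l' ->
  bmf (fun w => outer_bound (y w) (e w) N M M' l l') /\
  \int[P]_w outer_bound (y w) (e w) N M M' l l' <= outer_mean_bound N M M' l l'.
Proof.
move=> l0 l'0; have W0 : 0 <= \sum_(0 <= n < N) p n.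
  by apply: sumr_ge0 => n _; case/andP: (p01 n).
have i0 : 0 <= (2 * l)^-1 by rewrite invr_ge0 mulr_ge0// ltW.
have i0' : 0 <= (2 * l')^-1 by rewrite invr_ge0 mulr_ge0// ltW.
have I0 : 0 <= inner_mean_bound N M M' l'.
  by rewrite /inner_mean_bound; nonneg.
apply: mean_affine_sum_le.
- by nonneg.
- by nonneg.
- exact: bmf_sum_sqr_centered.
- exact: mean_sum_sqr_centered_le.
move=> m /andP[m1 _].
have [bi hi] := @mean_inner_bound_le N M M' l' m l'0 m1.
split; first by apply: bmfD; [exact: bmf_cst | exact: bmfZ].
by rewrite (meanD _ (bmf_cst _) (bmfZ _ bi)) mean_cst lerD2l (meanZ _ _ bi) ler_wpM2l.
Qed.

End BernoulliBound.

(* Here [x = N^a] and [t = N^delta], where [14 a + 10 delta = 1]. *)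
Lemma outer_mean_bound_le (R : realType) (p : nat -> R) (N M M' : nat) (x t : R) :
  1 <= x -> 1 <= t -> N%:R = x ^+ 14 * t ^+ 10 ->
  \sum_(0 <= n < N) p n <= 2 * N%:R / x ->
  x * t <= M%:R <= 2 * (x * t) -> x ^+ 4 * t ^+ 3 <= M'%:R <= 2 * (x ^+ 4 * t ^+ 3) ->
  outer_mean_bound p N M M' (N%:R / (x ^+ 3 * t ^+ 2)) (x ^+ 4 * t ^+ 3) <=
  270 * (N%:R ^+ 2 / (x ^+ 2 * t)).
Proof.
move=> x1 t1 NE WN /andP[M1 M2] /andP[M'1 M'2].
have x0 : 0 < x by exact: lt_le_trans x1.
have t0 : 0 < t by exact: lt_le_trans t1.
have N0 : 0 < N%:R :> R by rewrite NE mulr_gt0// exprn_gt0.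
have xt0 : 0 < x * t by rewrite mulr_gt0.
have q0 : 0 < x ^+ 4 * t ^+ 3 by rewrite mulr_gt0// exprn_gt0.
have ratio (K : nat) (z : R) : 0 < z -> z <= K%:R -> K%:R <= 2 * z -> z <= N%:R ->
    (0 : R) <= (N + K)%:R / K%:R <= 3 * N%:R / z.
  move=> z0 zK Kz zN; have K0 : 0 < K%:R :> R by exact: lt_le_trans zK.
  rewrite divr_ge0//= ler_pM ?invr_ge0//; last by rewrite lef_pV2 ?posrE.
  by rewrite natrD; lra.
have hx k : 1 <= x ^+ k by rewrite exprn_ege1.
have ht k : 1 <= t ^+ k by rewrite exprn_ege1.
have xtN : x * t <= N%:R.
  have -> : N%:R = x * t * (x ^+ 13 * t ^+ 9) by rewrite NE; ring.
  by rewrite ler_peMr ?(ltW xt0)// mulr_ege1.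
have qN : x ^+ 4 * t ^+ 3 <= N%:R.
  have -> : N%:R = x ^+ 4 * t ^+ 3 * (x ^+ 10 * t ^+ 7) by rewrite NE; ring.
  by rewrite ler_peMr ?(ltW q0)// mulr_ege1.
have /andP[A0 A1] := ratio M _ xt0 M1 M2 xtN.
have /andP[B0 B1] := ratio M' _ q0 M'1 M'2 qN.
have xn : x != 0 by rewrite gt_eqF.
have tn : t != 0 by rewrite gt_eqF.
have Nn : N%:R != 0 :> R by rewrite gt_eqF.
rewrite /outer_mean_bound /inner_mean_bound.
set W := \sum_(0 <= n < N) p n in WN *.
set A := _ / M%:R in A0 A1 *; set B := _ / M'%:R in B0 B1 *.
(* In units of N/x the bracket is 2 from the diagonal, 8 from the AM-GM constant (as x^13 t^10 =
   N/x), and 4 from the correlations; the window factor at most 3N/M' gives 3 * 14 = 42. *)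
have I1 : B * (W + M'%:R * (2 * (x ^+ 4 * t ^+ 3 / 2 * M%:R * M'%:R +
    (2 * (x ^+ 4 * t ^+ 3))^-1 * W))) <= 42 * (N%:R ^+ 2 / (x ^+ 5 * t ^+ 3)).
  apply: (@le_trans _ _ ((3 * N%:R / (x ^+ 4 * t ^+ 3)) *
    (2 * N%:R / x + 2 * (x ^+ 4 * t ^+ 3) * (2 * (x ^+ 4 * t ^+ 3 / 2 * (2 * (x * t)) *
      (2 * (x ^+ 4 * t ^+ 3)) + (2 * (x ^+ 4 * t ^+ 3))^-1 * (2 * N%:R / x)))))); last first.
    rewrite le_eqVlt; apply/orP; left; apply/eqP.
    by rewrite NE; field; rewrite xn tn.
  apply: (@le_trans _ _ (B * (2 * N%:R / x + 2 * (x ^+ 4 * t ^+ 3) * (2 * (x ^+ 4 * t ^+ 3 / 2 * (2 * (x * t)) *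
      (2 * (x ^+ 4 * t ^+ 3)) + (2 * (x ^+ 4 * t ^+ 3))^-1 * (2 * N%:R / x))))));
    last first.
    by apply: ler_wpM2r => //; nonneg.
  rewrite ler_wpM2l// lerD//.
  apply: (@le_trans _ _ (M'%:R * (2 * (x ^+ 4 * t ^+ 3 / 2 * (2 * (x * t)) *
      (2 * (x ^+ 4 * t ^+ 3)) + (2 * (x ^+ 4 * t ^+ 3))^-1 * (2 * N%:R / x)))));
    last first.
    by apply: ler_wpM2r => //; nonneg.
  rewrite ler_wpM2l// ler_wpM2l// lerD//; last first.
    by apply: ler_wpM2l => //; nonneg.
  apply: ler_pM => //; first by nonneg.
  by apply: ler_wpM2l => //; nonneg.
set I := B * _ in I1 *.
have l0 : 0 < N%:R / (x ^+ 3 * t ^+ 2) by rewrite divr_gt0// mulr_gt0// exprn_gt0.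
have J0 : 0 <= 42 * (N%:R ^+ 2 / (x ^+ 5 * t ^+ 3)).
  by nonneg.
set l := N%:R / _ in l0 *.
set Z := 2 * (x * t) * (2 * (l / 2 * (2 * (x * t)) +
      (2 * l)^-1 * (42 * (N%:R ^+ 2 / (x ^+ 5 * t ^+ 3))))).
have Z1 : 0 <= 2 * (l / 2 * (2 * (x * t)) + (2 * l)^-1 * (42 * (N%:R ^+ 2 / (x ^+ 5 * t ^+ 3)))).
  by nonneg.
have Z0 : 0 <= Z by rewrite /Z mulr_ge0// mulr_ge0// ltW.
(* In units of N/x: 2 from the diagonal, 4 from the AM-GM constant and 84 from the inner bound, so 3
   * 90 = 270. *)
apply: (@le_trans _ _ ((3 * N%:R / (x * t)) * (2 * N%:R / x + Z))); last first.
  rewrite le_eqVlt; apply/orP; left; apply/eqP.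
  by rewrite /Z /l; field; rewrite xn tn Nn.
apply: (@le_trans _ _ (A * (2 * N%:R / x + Z))); last first.
  by apply: ler_wpM2r => //; nonneg.
rewrite ler_wpM2l// lerD// /Z.
apply: (@le_trans _ _ (M%:R * (2 * (l / 2 * (2 * (x * t)) +
      (2 * l)^-1 * (42 * (N%:R ^+ 2 / (x ^+ 5 * t ^+ 3))))))); last by rewrite ler_wpM2r.
rewrite ler_wpM2l// ler_wpM2l// lerD//.
  by apply: ler_wpM2l => //; nonneg.
by apply: ler_wpM2l => //; nonneg.
Qed.

(** * Power densities *)

Section Density.
Variables (R : realType) (a : R).
Hypothesis a0 : 0 <= a.

Definition density (n : nat) : R := n.+1%:R `^ (- a).

Definition total (N : nat) : R := \sum_(0 <= n < N) density n.

Lemma density_gt0 n : 0 < density n.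
Proof. by rewrite powR_gt0. Qed.

Lemma density_le m n : (m <= n)%N -> density n <= density m.
Proof.
move=> mn; rewrite /density !powRN lef_pV2 ?posrE ?powR_gt0//.
by apply: ge0_ler_powR; rewrite ?nnegrE// ler_nat.
Qed.

Lemma density_le1 n : density n <= 1.
Proof.
by apply: le_trans (density_le (leq0n n)) _; rewrite /density powR1.
Qed.

Lemma powR_nat_ge1 (N : nat) (r : R) : (0 < N)%N -> 0 <= r -> 1 <= N%:R `^ r.
Proof. by move=> N0 r0; rewrite -[leLHS](powRr0 N%:R) ler_powR// ler1n. Qed.

Lemma total_ge N : (0 < N)%N -> N%:R / N%:R `^ a <= total N.
Proof.
case: N => // N _; rewrite mulr_natl -powRN -[X in _ *+ X]subn0 -sumr_const_nat.
by apply: ler_sum_nat => n /andP[_ nN]; exact: density_le.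
Qed.

Lemma total_le N : a <= 1 / 2 -> total N <= 2 * N%:R / N%:R `^ a.
Proof.
move=> a2; elim: N => [|N IH]; first by rewrite /total big_geq// mulr0 mul0r.
rewrite /total big_nat_recr//= -/(total N).
have y0 : 0 < N.+1%:R `^ a by rewrite powR_gt0.
have [->|N0] := posnP N.
  by rewrite /total big_geq// add0r /density -[1%:R]/1 !powR1 mulr1 invr1 mulr1; lra.
apply: (le_trans (lerD IH (lexx _))).
have x0 : 0 < N%:R `^ a by rewrite powR_gt0// ltr0n.
have NR : 0 < N%:R :> R by rewrite ltr0n.
(* No calculus is involved: [N + 1] is at most N (1 + 1/(2N))^2, and the resulting power [2 * a] is
   at most 1 on a base that is at least 1. *)
have H : N.+1%:R `^ a <= N%:R `^ a * (1 + (2 * N%:R)^-1).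
  have e1 : 1 <= 1 + (2 * N%:R)^-1 :> R by rewrite lerDl invr_ge0 mulr_ge0.
  apply: (@le_trans _ _ (N%:R `^ a * (1 + (2 * N%:R)^-1) `^ (2 * a))); last first.
    rewrite ler_wpM2l ?(ltW x0)// -[leRHS]powRr1 ?(le_trans _ e1)//.
    by apply: ler_powR => //; lra.
  rewrite powRrM powR_mulrn ?(le_trans _ e1)// -powRM ?sqr_ge0//.
  apply: ge0_ler_powR => //; rewrite ?nnegrE//.
  have -> : N%:R * (1 + (2 * N%:R)^-1) ^+ 2 = N.+1%:R + (4 * N%:R)^-1 :> R.
    by rewrite -natr1; field; rewrite gt_eqF.
  by rewrite lerDl invr_ge0 mulr_ge0.
have K : 2 * N%:R * N.+1%:R `^ a <= (2 * N%:R + 1) * N%:R `^ a.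
  apply: le_trans (ler_wpM2l _ H) _; first by rewrite mulr_ge0.
  by rewrite le_eqVlt; apply/orP; left; apply/eqP; field; rewrite gt_eqF.
rewrite /density powRN; move: K H x0 y0; rewrite -[N.+1%:R]natr1.
set X := N%:R `^ a; set Y := (_ `^ a) => K H x0 y0.
rewrite -subr_ge0 (_ : _ - _ = ((2 * N%:R + 1) * X - 2 * N%:R * Y) / (X * Y)).
  by rewrite divr_ge0 ?subr_ge0// mulr_ge0 ?ltW.
by field; rewrite !gt_eqF.
Qed.

End Density.

(** * Choice of the parameters and the almost sure event *)

Section AlmostSure.
Context {d : measure_display} {Omega : measurableType d} {R : realType}.
Variables (P : probability Omega R) (e : Omega -> nat -> bool) (a : R).
Hypothesis ha : 0 < a < 1 / 14.
Hypothesis bmf_e : forall n, bmf (fun w => (e w n)%:R : R).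
Hypothesis indep_e : forall (L : seq nat) (v : nat -> bool), uniq L ->
  \int[P]_w (all (fun i => e w i == v i) L)%:R =
  \prod_(i <- L) (if v i then density a i else 1 - density a i).

Let y w := centered (density a) (e w).

Let density01 n : 0 <= density a n <= 1.
Proof. by case/andP: ha => a0 _; rewrite ltW ?density_gt0// density_le1// ltW. Qed.

Lemma outer_bound_ge0 (z : nat -> R) f N M M' l l' : 0 < l -> 0 < l' ->
  0 <= outer_bound z f N M M' l l'.
Proof.
move=> l0 l'0; rewrite /outer_bound /inner_bound.
by repeat first [progress nonneg | apply: sumr_ge0 => ? _].
Qed.

Lemma exists_outer_bound_le N : (0 < N)%N ->
  exists M M' : nat, exists l l' : R,
  [/\ (0 < M)%N, (0 < M')%N, 0 < l, 0 < l' &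
   \int[P]_w outer_bound (y w) (e w) N M M' l l' <=
     270 / N%:R `^ ((1 - 14 * a) / 10) * total a N ^+ 2].
Proof.
move=> N0; have /andP[a0 a14] := ha; set dl := (1 - 14 * a) / 10.
have dl0 : 0 < dl by rewrite /dl; lra.
pose x := N%:R `^ a; pose t := N%:R `^ dl.
have x1 : 1 <= x by rewrite powR_nat_ge1// ltW.
have t1 : 1 <= t by rewrite powR_nat_ge1// ltW.
have x0 : 0 < x by exact: lt_le_trans x1.
have t0 : 0 < t by exact: lt_le_trans t1.
have NR : 0 < N%:R :> R by rewrite ltr0n.
have NE : N%:R = x ^+ 14 * t ^+ 10.
  rewrite /x /t -!powR_mulrn ?powR_ge0// -!powRrM -powRD.
    by rewrite (_ : _ + _ = 1) ?powRr1//; rewrite /dl; field.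
  by apply/implyP => _; rewrite gt_eqF.
pose M := (Num.trunc (x * t)).+1; pose M' := (Num.trunc (x ^+ 4 * t ^+ 3)).+1.
(* Rounding up to an integer loses at most a factor 2, because the targets are at least 1. *)
have hM (z : R) : 1 <= z -> z <= (Num.trunc z).+1%:R <= 2 * z.
  move=> z1; have /truncn_itv/andP[h1 h2] : 0 <= z by exact: le_trans z1.
  by rewrite (ltW h2) -natr1; lra.
have xt1 : 1 <= x * t by rewrite mulr_ege1.
have q1 : 1 <= x ^+ 4 * t ^+ 3 by rewrite mulr_ege1// exprn_ege1.
exists M, M', (N%:R / (x ^+ 3 * t ^+ 2)), (x ^+ 4 * t ^+ 3).
have l0 : 0 < N%:R / (x ^+ 3 * t ^+ 2) by rewrite divr_gt0// mulr_gt0// exprn_gt0.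
have l'0 : 0 < x ^+ 4 * t ^+ 3 by exact: lt_le_trans q1.
split => //.
have [_ h] := mean_outer_bound_le bmf_e density01 indep_e N M M' l0 l'0.
apply: (le_trans h).
apply: le_trans (@outer_mean_bound_le _ (density a) N M M' x t _ _ _ _ _ _) _ => //.
- by apply: total_le; [exact: ltW | lra].
- exact: hM.
- exact: hM.
have -> : N%:R ^+ 2 / (x ^+ 2 * t) = t^-1 * (N%:R / x) ^+ 2.
  by field; rewrite !gt_eqF.
have c0 : 0 <= 270 :> R by exact: ler0n.
set c := 270 in c0 *; rewrite [leLHS]mulrA; apply: ler_wpM2l; first by nonneg.
rewrite lerXn2r ?nnegrE//.
- by rewrite divr_ge0// ltW.
- by apply: sumr_ge0 => n _; exact/ltW/density_gt0.
- by apply: total_ge => //; exact: ltW.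
Qed.

Lemma sum_inv_sqr_le n : \sum_(0 <= k < n) (k.+1%:R ^+ 2)^-1 <= 2 :> R.
Proof.
suff: forall m, \sum_(0 <= k < m.+1) (k.+1%:R ^+ 2)^-1 <= 2 - m.+1%:R^-1 :> R.
  case: n => [|n] h; first by rewrite big_geq.
  by apply: le_trans (h n) _; rewrite lerBlDr lerDl.
elim=> [|m IH]; first by rewrite big_nat1 expr1n invr1; lra.
rewrite big_nat_recr//=; apply: (le_trans (lerD IH (lexx _))).
rewrite -[m.+2%:R]natr1; set z := m.+1%:R.
have z0 : 0 < z :> R by rewrite /z ltr0n.
have z1 : 0 < z + 1 by rewrite addr_gt0.
rewrite -subr_ge0 (_ : _ - _ = (z * (z + 1) ^+ 2)^-1).
  by rewrite invr_ge0 mulr_ge0 ?sqr_ge0 ?ltW.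
by field; rewrite !gt_eqF.
Qed.

(** The condition on omega that replaces all probabilistic information in the later argument. It
    mentions no system, and after division by the squared total it is directly a summability
    statement along the sparse times. *)
Definition controlled (q : nat) (f : nat -> bool) : Prop :=
  exists (M M' : nat -> nat) (l l' : nat -> R) (C : R),
   (forall k, [/\ (0 < M k)%N, (0 < M' k)%N, 0 < l k & 0 < l' k]) /\
   forall n, \sum_(0 <= k < n)
     outer_bound (centered (density a) f) f (k.+1 ^ q) (M k) (M' k) (l k) (l' k) /
     total a (k.+1 ^ q) ^+ 2 <= C.

Lemma ae_controlled : exists2 q : nat, (0 < q)%N & {ae P, forall w, controlled q (e w)}.
Proof.
have /andP[a0 a14] := ha; set dl := (1 - 14 * a) / 10.
have dl0 : 0 < dl by rewrite /dl; lra.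
(* With [q * dl >= 2] the gain [N^dl] at [N = (k+1)^q] is at least [(k+1)^2], so the expectations
   are summable. *)
pose q := (Num.trunc (2 / dl)).+1; exists q => //.
have qdl : 2 <= q%:R * dl.
  by rewrite -ler_pdivrMr// ltW// truncnS_gt.
have N0 k : (0 < k.+1 ^ q)%N by rewrite expn_gt0.
have total_gt0 k : 0 < total a (k.+1 ^ q).
  apply: lt_le_trans (total_ge (ltW a0) (N0 k)).
  by rewrite divr_gt0 ?ltr0n// powR_gt0// ltr0n.
have /choice[M hM] k := exists_outer_bound_le (N0 k).
have /choice[M' hM'] := hM.
have /choice[l hl] := hM'.
have /choice[l' hl'] := hl.
pose D k w := outer_bound (y w) (e w) (k.+1 ^ q) (M k) (M' k) (l k) (l' k) /
     total a (k.+1 ^ q) ^+ 2.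
have bD k : bmf (D k).
  rewrite /D; under eq_fun do rewrite mulrC; apply: bmfZ.
  have [_ _ l0 l'0 _] := hl' k.
  by have [] := mean_outer_bound_le bmf_e density01 indep_e (k.+1 ^ q) (M k) (M' k) l0 l'0.
have D0 k w : 0 <= D k w.
  by have [_ _ l0 l'0 _] := hl' k; rewrite divr_ge0 ?sqr_ge0 ?outer_bound_ge0.
have c0 : 0 <= 270 :> R by exact: ler0n.
have ED n : \sum_(0 <= k < n) \int[P]_w D k w <= 270 * 2.
  apply: (@le_trans _ _ (\sum_(0 <= k < n) 270 * (k.+1%:R ^+ 2)^-1)); last first.
    set c := 270 in c0 *.
    by rewrite -mulr_sumr ler_wpM2l// sum_inv_sqr_le.
  apply: ler_sum_nat => k _; have [_ _ l0 l'0 h] := hl' k.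
  have [bo _] := mean_outer_bound_le bmf_e density01 indep_e (k.+1 ^ q) (M k) (M' k) l0 l'0.
  rewrite /D; under eq_Rintegral do rewrite mulrC.
  rewrite (meanZ _ _ bo) mulrC ler_pdivrMr ?exprn_gt0//.
  apply: (le_trans h); set c := 270 in c0 *; rewrite ler_wpM2r ?sqr_ge0// ler_wpM2l// lef_pV2 ?posrE ?exprn_gt0//.
  rewrite natrX -powR_mulrn// -powRrM -(powR_mulrn 2)//.
  by apply: ler_powR => //; rewrite ler1n.
have := ae_bounded_partial_sums bD D0 ED.
apply: filterS => w [C hC]; exists M, M', l, l', C; split => // k.
by have [? ? ? ? _] := hl' k; split.
Qed.

End AlmostSure.

(** * Maximal and pointwise ergodic theorems *)

Lemma measurable_superlevel d (Y : measurableType d) (R : realType) (u : Y -> R) (c : R) :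
  measurable_fun setT u -> measurable [set x | c < u x].
Proof.
move=> mu_; have := mu_ measurableT `]c, +oo[%classic (measurable_itv _).
rewrite setTI; congr measurable; apply/seteqP.
by split=> x /=; rewrite in_itv/= andbT.
Qed.

Lemma measurable_ltr_set d (Y : measurableType d) (R : realType) (u v : Y -> R) :
  measurable_fun setT u -> measurable_fun setT v -> measurable [set x | u x < v x].
Proof.
move=> mu_ mv; rewrite (_ : [set x | _] = [set x | 0 < (v \- u) x]).
  by apply: measurable_superlevel; exact: measurable_funB.
by apply/seteqP; split => x /=; rewrite subr_gt0.
Qed.

Section ErgodicTheorems.
Context {d : measure_display} {Y : measurableType d} {R : realType}.
Variables (mu : probability Y R) (T : Y -> Y).
Hypothesis mpT : measure_preserving mu T.
Implicit Types (k h u : Y -> R).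

Definition birkhoff_sum h n x : R := \sum_(0 <= i < n) h (iter i T x).

Lemma birkhoff_sumS h n x : birkhoff_sum h n.+1 x = h x + birkhoff_sum h n (T x).
Proof.
rewrite /birkhoff_sum big_nat_recl//; congr (_ + _); apply: eq_bigr => i _.
by rewrite -iterSr.
Qed.

Lemma bmf_T h : bmf h -> bmf (fun x => h (T x)).
Proof. by case: mpT => mT _; exact: bmf_comp. Qed.

Lemma bmf_birkhoff_sum h n : bmf h -> bmf (birkhoff_sum h n).
Proof.
move=> bh; apply: bmf_sum => i _.
by have [mi _] := measure_preserving_iter i mpT; exact: bmf_comp.
Qed.

(* The running maximum of the Birkhoff sums of lengths [0, ..., n]. *)
Fixpoint maximal_sum h n x : R :=
  if n is n'.+1 then Num.max 0 (h x + maximal_sum h n' (T x)) else 0.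

Lemma maximal_sum_ge0 h n x : 0 <= maximal_sum h n x.
Proof. by case: n => //= n; rewrite le_max lexx. Qed.

Lemma maximal_sum_leS h n x : maximal_sum h n x <= maximal_sum h n.+1 x.
Proof.
elim: n x => [|n IH] x; first exact: maximal_sum_ge0.
rewrite [leLHS]/= [leRHS]/= -/(maximal_sum h n.+1 (T x)).
by rewrite ge_max !le_max lexx/= lerD2l IH orbT.
Qed.

Lemma maximal_sum_mono h m n x : (m <= n)%N -> maximal_sum h m x <= maximal_sum h n x.
Proof.
by move/subnK <-; elim: (n - m)%N => // j IH; apply: le_trans IH (maximal_sum_leS _ _ _).
Qed.

Lemma birkhoff_sum_le_maximal h n x : birkhoff_sum h n x <= maximal_sum h n x.
Proof.
elim: n x => [|n IH] x; first by rewrite /birkhoff_sum big_geq.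
by rewrite birkhoff_sumS /= le_max lerD2l IH orbT.
Qed.

Lemma bmf_maximal_sum h n : bmf h -> bmf (maximal_sum h n).
Proof.
move=> bh; elim: n => [|n IH] /=; first exact: bmf_cst.
by apply: bmf_max; [exact: bmf_cst | apply: bmfD => //; exact: bmf_T].
Qed.

Lemma measurable_maximal_pos h n : bmf h -> measurable [set x | 0 < maximal_sum h n x].
Proof. by move=> bh; apply: measurable_superlevel; case: (bmf_maximal_sum n bh). Qed.

(** Garsia's argument: where the running maximum is positive it equals [h x] plus the shorter
    maximum at [T x], and elsewhere it is 0. So its difference with its own composition with [T]
    lies below the integrand, and that difference has integral 0. *)
Lemma maximal_ergodic h n : bmf h ->
  0 <= \int[mu]_x (\1_[set x | 0 < maximal_sum h n x] x * h x).
Proof.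
move=> bh; have bm := bmf_maximal_sum n bh.
have bi : bmf (\1_[set x | 0 < maximal_sum h n x] : Y -> R).
  by apply: bmf_indic; exact: measurable_maximal_pos.
apply: (@le_trans _ _ (\int[mu]_x (maximal_sum h n x - maximal_sum h n (T x)))).
  by rewrite meanB ?mean_comp ?subrr//; exact: bmf_T.
apply: le_mean => [||x]; [by apply: bmfB => //; exact: bmf_T|exact: bmfM|].
rewrite indicE; have [hx|hx] := ltP 0 (maximal_sum h n x); last first.
  rewrite memNset ?mul0r; last by move=> /= /lt_geF; rewrite hx.
  by rewrite lerBlDr add0r (le_trans hx)// maximal_sum_ge0.
rewrite mem_set// mul1r lerBlDr; case: n hx {bm bi} => [|n]; first by rewrite ltxx.
rewrite {1 2}/maximal_sum -/maximal_sum lt_max ltxx/= => hx.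
by rewrite max_r ?(ltW hx)// lerD2l -/(maximal_sum h n.+1 (T x)) maximal_sum_leS.
Qed.

Lemma birkhoff_sumB_cst h (c : R) n x :
  birkhoff_sum (fun x => h x - c) n x = birkhoff_sum h n x - n%:R * c.
Proof. by rewrite /birkhoff_sum sumrB sumr_const_nat subn0 mulr_natl. Qed.

(** The maximal ergodic theorem for [h - c] bounds [c] times the measure of each set [F n] by the
    mean of [h]; these sets increase to the exceptional set. *)
Lemma maximal_inequality h (c : R) : bmf h -> (forall x, 0 <= h x) -> 0 < c ->
  exists B : set Y, [/\ measurable B, (mu B <= ((\int[mu]_x h x) / c)%:E)%E &
    forall x n, n%:R * c < birkhoff_sum h n x -> B x].
Proof.
move=> bh h0 c0; pose k x := h x - c.
have bk : bmf k by apply: bmfB => //; exact: bmf_cst.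
pose F n := [set x | 0 < maximal_sum k n x].
have mF n : measurable (F n) by exact: measurable_maximal_pos.
have muF n : (mu (F n) <= ((\int[mu]_x h x) / c)%:E)%E.
  rewrite -[leLHS]fineK ?fin_num_measure// lee_fin ler_pdivlMr// -mean_indic// mulrC.
  have bi : bmf (\1_(F n) : Y -> R) by exact: bmf_indic.
  rewrite -meanZ// -subr_ge0 -meanB//; last exact: bmfZ.
  apply: le_trans (maximal_ergodic n bk) _; apply: le_mean => [||x].
  - exact: bmfM.
  - by apply: bmfB => //; exact: bmfZ.
  - rewrite /k -/(F n) indicE; case: (_ \in _) => /=; first by rewrite mul1r mulr1.
    by rewrite mul0r mulr0 subr0.
exists (\bigcup_n F n); split.
- exact: bigcup_measurable.
- have mono : {homo F : n m / (n <= m)%N >-> (n <= m)%O}.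
    by move=> n m nm; apply/subsetPset => x /lt_le_trans; apply; exact: maximal_sum_mono.
  have cv := @nondecreasing_cvg_mu _ _ _ mu F mF (bigcup_measurable (fun n _ => mF n)) mono.
  rewrite -(cvg_lim _ cv)//; apply: lime_le; first by apply/cvg_ex; eexists; exact: cv.
  by apply: nearW => n; exact: muF.
- move=> x n hx; exists n => //; rewrite /F /=.
  apply: lt_le_trans (birkhoff_sum_le_maximal _ _ _).
  by rewrite birkhoff_sumB_cst subr_gt0.
Qed.

Lemma invariant_mem (A : set Y) n x : T @^-1` A = A -> (iter n T x \in A) = (x \in A).
Proof.
move=> TA; elim: n => //= n <-; rewrite -[in RHS]TA.
by apply/idP/idP => /set_mem h; exact/mem_set.
Qed.

Lemma unbounded_birkhoff_null k (eps : R) : bmf k -> 0 < eps ->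
  (forall A, invariant_sets T A -> \int[mu]_x (\1_A x * k x) <= - eps * fine (mu A)) ->
  {ae mu, forall x, exists c : nat, forall n, birkhoff_sum k n x <= c%:R}.
Proof.
(* Unlike exceeding a level infinitely often, having unbounded sums is an exactly
   invariant property. *)
move=> bk e0 hk; pose A := \bigcap_c \bigcup_n [set x | c%:R < birkhoff_sum k n x].
have [mk [C hC]] := bk.
have mA : measurable A.
  apply: bigcap_measurable => // c _; apply: bigcup_measurable => n _.
  by apply: measurable_superlevel; case: (bmf_birkhoff_sum n bk).
have C0 : Y -> 0 <= C by move=> x; exact: le_trans (normr_ge0 _) (hC x).
have TA : T @^-1` A = A.
  apply/seteqP; split => x Ax c _; rewrite /=.
    have [n _ /= hn] := Ax (c + Num.bound C)%N Logic.I.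
    exists n.+1 => //=; rewrite birkhoff_sumS.
    have Cb : C < (Num.bound C)%:R by apply: archi_boundP; exact: C0 x.
    rewrite natrD in hn; have := hC x; rewrite ler_norml => /andP[h1 _].
    by move: hn Cb h1; clear; lra.
  have [n _ /= hn] := Ax (c + Num.bound C)%N Logic.I.
  have Cb : C < (Num.bound C)%:R by apply: archi_boundP; exact: C0 x.
  case: n hn => [|n]; first by rewrite /birkhoff_sum big_geq// ltrn0.
  rewrite birkhoff_sumS natrD => hn; exists n => //=.
  have := hC x; rewrite ler_norml => /andP[_ h2].
  by move: hn Cb h2; clear; lra.
have invA : invariant_sets T A by split.
pose k' x := \1_A x * k x.
have bA : bmf (\1_A : Y -> R) by exact: bmf_indic.
have bk' : bmf k' by exact: bmfM.
pose E n := [set x | 0 < maximal_sum k' n x].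
have mE n : measurable (E n) by exact: measurable_maximal_pos.
have AE : A `<=` \bigcup_n E n.
  move=> x Ax; have [n _ /= hn] := Ax 0%N Logic.I; exists n => //=.
  apply: lt_le_trans (birkhoff_sum_le_maximal _ _ _).
  rewrite (_ : birkhoff_sum k' n x = birkhoff_sum k n x)//.
  apply: eq_bigr => i _; rewrite /k' indicE invariant_mem//.
  by rewrite (_ : x \in A = true) ?mul1r//; exact/mem_set.
(* The maximal ergodic theorem for [k'] concerns [E n] and not [A]; restricting to [A] is free, and
   the part of [A] missed by [E n] costs at most [C] times its measure. In the limit the integral of
   [k] over [A] is nonnegative, against [hk]. *)
have bound n : - (C * fine (mu (A `\` E n))) <= \int[mu]_x (\1_A x * k x).
  have bE : bmf (\1_(E n) : Y -> R) by exact: bmf_indic.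
  have mD : measurable (A `\` E n) by exact: measurableD.
  have bD : bmf (\1_(A `\` E n) : Y -> R) by exact: bmf_indic.
  have bEk : bmf (fun x => \1_(E n) x * k' x) by exact: bmfM.
  have := maximal_ergodic n bk'; rewrite -/(E n) => hE.
  rewrite -mean_indic// -mulNr -meanZ//.
  rewrite -[leLHS]add0r; apply: (le_trans (lerD hE (lexx _))).
  rewrite -meanD//; last exact: bmfZ.
  apply: le_mean => [||x]; [by apply: bmfD => //; exact: bmfZ|exact: bmfM|].
  rewrite /k' !indicE in_setD; have := hC x; rewrite ler_norml => /andP[h1 _].
  by case: (x \in A); case: (x \in E n) => /=; rewrite ?(mul0r, mul1r, mulr0, mulr1, addr0, add0r).
have cvD : (fun n => fine (mu (A `\` E n))) @ \oo --> (0 : R).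
  have D0 : \bigcap_n (A `\` E n) = set0.
    apply/seteqP; split => // x Dx; have [Ax _] := Dx 0%N Logic.I.
    by have [n _ En] := AE x Ax; have [_] := Dx n Logic.I.
  have mono : {homo (fun n => A `\` E n) : n m / (n <= m)%N >-> (m <= n)%O}.
    move=> n m nm; apply/subsetPset => x [Ax nE]; split => // En; apply: nE.
    by apply: lt_le_trans En _; exact: maximal_sum_mono.
  have mD n : measurable (A `\` E n) by exact: measurableD.
  apply: fine_cvg; rewrite (_ : 0%:E = mu (\bigcap_n (A `\` E n))); last first.
    by rewrite D0 measure0.
  apply: (nonincreasing_cvg_mu _ mD (bigcap_measurable _ (fun n _ => mD n)) mono) => //.
  by rewrite (le_lt_trans (probability_le1 _ _))// ltry.
have I0 : 0 <= \int[mu]_x (\1_A x * k x).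
  have cvC : (fun n => - (C * fine (mu (A `\` E n)))) @ \oo --> (0 : R).
    by rewrite -oppr0 -(mulr0 C); apply: cvgN; exact: cvgMr.
  by rewrite -(cvg_lim _ cvC)//; apply: limr_le; [apply/cvg_ex; eexists; exact: cvC|exact: nearW].
have muA : mu A = 0%E.
  have := hk A invA => /(le_trans I0); rewrite mulNr oppr_ge0 pmulr_rle0// => f0.
  rewrite -[LHS]fineK ?fin_num_measure//; congr EFin; apply/eqP.
  by rewrite eq_le f0 fine_ge0.
exists A; split => // x /= nx c _; apply: contrapT => hx; apply: nx; exists c => n.
by rewrite leNgt; apply/negP => hn; apply: hx; exists n.
Qed.

End ErgodicTheorems.

(* Equivalent to [s = o(w)] when [w] tends to infinity. *)
Definition little_o (R : realType) (w s : nat -> R) : Prop :=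
  forall eps : R, 0 < eps -> exists C : R, forall n, `|s n| <= eps * w n + C.

Section LittleO.
Variables (R : realType) (w : nat -> R).
Hypothesis w0 : forall n, 0 <= w n.

Lemma little_oD s s' : little_o w s -> little_o w s' ->
  little_o w (fun n => s n + s' n).
Proof.
move=> hs hs' eps e0; have e2 : 0 < eps / 2 by lra.
have [C hC] := hs _ e2; have [C' hC'] := hs' _ e2; exists (C + C') => n.
apply: (le_trans (ler_normD _ _)); have := hC n; have := hC' n; lra.
Qed.

Lemma little_oZ (c : R) s : little_o w s -> little_o w (fun n => c * s n).
Proof.
move=> hs eps e0; have c0 : 0 < `|c| + 1 by rewrite ltr_wpDl.
have e2 : 0 < eps / (`|c| + 1) by rewrite divr_gt0.
have [C hC] := hs _ e2; exists (`|c| * C) => n; rewrite normrM.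
apply: (le_trans (ler_wpM2l (normr_ge0 c) (hC n))); rewrite mulrDr lerD2r.
rewrite mulrA ler_wpM2r// mulrCA ler_piMr ?(ltW e0)//.
by rewrite ler_pdivrMr// mul1r lerDl.
Qed.

Lemma little_oB s s' : little_o w s -> little_o w s' ->
  little_o w (fun n => s n - s' n).
Proof.
move=> hs hs'; have := little_oD hs (little_oZ (-1) hs').
by under eq_fun do rewrite mulN1r.
Qed.

Lemma eq_little_o s s' : s =1 s' -> little_o w s -> little_o w s'.
Proof. by move=> /funext ->. Qed.

End LittleO.

Lemma little_o_cvg (R : realType) (s : nat -> R) (c : R) :
  little_o (fun n => n%:R) (fun n => s n - n%:R * c) ->
  (fun n => n%:R^-1 * s n) @ \oo --> c.
Proof.
move=> hs; apply/cvgrPdist_le => eps e0; have e2 : 0 < eps / 2 by lra.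
have [C hC] := hs _ e2.
near=> n; have n0 : 0 < n%:R :> R by rewrite ltr0n; near: n; exact: nbhs_infty_gt.
rewrite -(ler_pM2l n0).
have -> : n%:R * `|c - n%:R^-1 * s n| = `|s n - n%:R * c|.
  rewrite -{1}(gtr0_norm n0) -normrM -normrN; congr (`|_|).
  by field; rewrite gt_eqF.
apply: (le_trans (hC n)); suff : C <= n%:R * (eps / 2) by lra.
rewrite -ler_pdivrMr//; near: n; exact: nbhs_infty_ger.
Unshelve. all: by end_near. Qed.

Section Birkhoff.
Context {d : measure_display} {Y : measurableType d} {R : realType}.
Variables (mu : probability Y R) (T : Y -> Y).
Hypothesis mpT : measure_preserving mu T.

(** Subtracting [eps] from [h] makes its integral over an invariant set [A] equal to [- eps * mu A],
    so the sums of [h - eps] are almost surely bounded above. Taking [eps] over the inverses of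
    positive integers, and [- h] as well, gives the two-sided estimate. *)
Lemma birkhoff_ae (h : Y -> R) : bmf h ->
  (forall A, invariant_sets T A -> \int[mu]_x (\1_A x * h x) = 0) ->
  {ae mu, forall x, little_o (fun n => n%:R) (fun n => birkhoff_sum T h n x)}.
Proof.
move=> bh h0.
have half (u : Y -> R) : bmf u ->
    (forall A, invariant_sets T A -> \int[mu]_x (\1_A x * u x) = 0) ->
    {ae mu, forall x, forall j : nat, exists c : nat, forall n,
      birkhoff_sum T u n x <= n%:R * j.+1%:R^-1 + c%:R}.
  move=> bu u0; apply: ae_foralln => j; pose eps : R := j.+1%:R^-1.
  have e0 : 0 < eps by rewrite /eps invr_gt0 ltr0n.
  have bk : bmf (fun x => u x - eps) by apply: bmfB => //; exact: bmf_cst.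
  have hk A : invariant_sets T A ->
      \int[mu]_x (\1_A x * (u x - eps)) <= - eps * fine (mu A).
    move=> iA; have mA := iA.1; have bA : bmf (\1_A : Y -> R) by exact: bmf_indic.
    have bAu : bmf (fun x => \1_A x * u x) by exact: bmfM.
    under eq_Rintegral do rewrite mulrBr [_ * eps]mulrC.
    by rewrite (meanB _ bAu (bmfZ eps bA)) u0// (meanZ _ _ bA) mean_indic// sub0r mulNr.
  have := unbounded_birkhoff_null mpT bk e0 hk.
  apply: filterS => x [c hc]; exists c => n.
  by have := hc n; rewrite birkhoff_sumB_cst lerBlDr addrC.
have [bN hN] : bmf (fun x => - h x) /\ forall A, invariant_sets T A ->
    \int[mu]_x (\1_A x * - h x) = 0.
  split=> [|A iA]; first exact: bmfN.
  have bA : bmf (\1_A : Y -> R) by apply: bmf_indic; exact: iA.1.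
  under eq_Rintegral do rewrite mulrN -mulN1r.
  by rewrite (meanZ _ _ (bmfM bA bh)) h0// mulr0.
have H1 := half _ bh h0; have H2 := half _ bN hN.
apply: filterS2 H1 H2 => x h1 h2 eps e0.
pose j := Num.bound eps^-1.
have je : j.+1%:R^-1 <= eps.
  rewrite -[leRHS]invrK lef_pV2 ?posrE ?invr_gt0 ?ltr0n// ltW//.
  apply: lt_trans (archi_boundP _) _; first by rewrite invr_ge0 ltW.
  by rewrite ltr_nat.
have [c1 hc1] := h1 j; have [c2 hc2] := h2 j.
exists (c1%:R + c2%:R) => n.
have hn : n%:R * j.+1%:R^-1 <= eps * n%:R by rewrite mulrC ler_wpM2r.
have := hc1 n; have := hc2 n.
have -> : birkhoff_sum T (fun x => - h x) n x = - birkhoff_sum T h n x.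
  by rewrite /birkhoff_sum sumrN.
have c10 : 0 <= c1%:R :> R by []. have c20 : 0 <= c2%:R :> R by [].
rewrite ler_norml; move: hn c10 c20; set S := birkhoff_sum _ _ _ _.
move: (n%:R * _) (eps * _) (c1%:R) (c2%:R) S => p1 p2 p3 p4 S; clear.
move=> a1 a2 a3 a4 a5; apply/andP; split; lra.
Qed.

(** Pointwise convergence becomes L^1 convergence by domination with the bound of [h]. The L^1 form
    is what the maximal inequality can be applied to. *)
Lemma mean_birkhoff_average_small (h : Y -> R) (eta : R) : bmf h -> 0 < eta ->
  (forall A, invariant_sets T A -> \int[mu]_x (\1_A x * h x) = 0) ->
  exists2 L : nat, (0 < L)%N & \int[mu]_x (`|birkhoff_sum T h L x| / L%:R) <= eta.
Proof.
move=> bh eta0 h0; have [mh [C hC]] := bh.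
pose F (n : nat) x := (`|birkhoff_sum T h n x| / n%:R).
have bF n : bmf (F n).
  by apply: bmfM; [exact/bmf_norm/(bmf_birkhoff_sum mpT) | exact: bmf_cst].
have FC n x : `|F n x| <= C.
  rewrite /F normrM normr_id normfV normr_nat.
  have [->|n0] := posnP n; first by rewrite invr0 mulr0 (le_trans _ (hC x)).
  rewrite ler_pdivrMr ?ltr0n//; apply: (le_trans (ler_norm_sum _ _ _)).
  rewrite mulrC mulr_natl -[X in _ *+ X]subn0 -sumr_const_nat.
  by apply: ler_sum_nat => i _; exact: hC.
have cvF : {ae mu, forall x, (fun n => (F n x)%:E) @ \oo --> 0%:E}.
  apply: filterS (birkhoff_ae bh h0) => x hx; apply: cvg_EFin; first exact: nearW.
  have : (fun n => n%:R^-1 * `|birkhoff_sum T h n x|) @ \oo --> (0 : R).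
    apply: little_o_cvg => eps e0; have [K hK] := hx eps e0; exists K => n.
    by rewrite mulr0 subr0 normr_id.
  by apply: cvg_trans; apply: near_eq_cvg; apply: nearW => n /=; rewrite /F mulrC.
have mF n : measurable_fun setT (EFin \o F n).
  by apply: measurableT_comp => //; exact: (bF n).1.
have [|||_ _ h3] := @dominated_convergence _ _ _ mu setT measurableT (fun n x => (F n x)%:E)
  (cst 0%E) (cst C%:E) mF (measurable_cst _).
- by apply: filterS cvF => x hx _.
- exact: (bmf_integrable mu (bmf_cst C)).
- by apply/aeW => x n _; rewrite /= lee_fin.
have c3 : (fun n => \int[mu]_x F n x) @ \oo --> (0 : R).
  by apply: fine_cvg; move: h3; rewrite integral0.
have : \forall n \near \oo, \int[mu]_x F n x <= eta /\ (0 < n)%N.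
  near=> n; split; last by near: n; exact: nbhs_infty_gt.
  near: n; apply: (cvgr_le 0 c3); exact: eta0.
by case=> N _ hN; have [h1 h2] := hN N (leqnn N); exists N.
Unshelve. all: by end_near. Qed.

End Birkhoff.

(** * Truncated conditional expectations *)

Section TruncatedConditionalExpectation.
Context {d : measure_display} {Y : measurableType d} {R : realType}.
Variables (mu : probability Y R) (T : Y -> Y).

Definition truncate (M : R) (f : Y -> R) (x : Y) : R := if `|f x| <= M then f x else 0.

Lemma bmf_truncate M f : measurable_fun setT f -> bmf (truncate M f).
Proof.
move=> mf; split.
  apply: measurable_fun_ifT => //.
  by apply: measurable_fun_ler => //; exact: measurableT_comp.
exists `|M| => x; rewrite /truncate; case: ifP => [fM|]; last by rewrite normr0.
by rewrite (le_trans fM)// ler_norm.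
Qed.

Lemma norm_truncate M f x : 0 <= M -> `|truncate M f x| <= M.
Proof. by move=> M0; rewrite /truncate; case: ifP => //; rewrite normr0. Qed.

Lemma mean_indicE (A : set Y) (u : Y -> R) :
  \int[mu]_x (\1_A x * u x) = \int[mu]_(x in A) u x.
Proof.
rewrite [RHS]Rintegral_mkcond; apply: eq_Rintegral => x _.
by rewrite patchE indicE; case: (x \in A); rewrite ?mul1r ?mul0r.
Qed.

(** The margin 1 makes the conclusion immediate: [(M + 1) * mu A] is at most the common integral,
    which is at most [M * mu A]. *)
Lemma cond_exp_bounded_above (M : R) (f h : Y -> R) (A : set Y) :
  bmf f -> (forall x, f x <= M) -> mu.-integrable setT (EFin \o h) ->
  measurable A -> (forall x, A x -> M + 1 <= h x) ->
  \int[mu]_(x in A) h x = \int[mu]_(x in A) f x -> mu A = 0%E.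
Proof.
move=> bf fM ih mA hA h3.
have iA u : mu.-integrable setT (EFin \o u) -> mu.-integrable A (EFin \o u).
  by apply: integrableS.
have ic (c : R) : mu.-integrable A (EFin \o (fun _ : Y => c)).
  by apply: iA; apply: bmf_integrable; exact: bmf_cst.
have h1 : (M + 1) * fine (mu A) <= \int[mu]_(x in A) h x.
  by rewrite -Rintegral_cst//; apply: le_Rintegral => //; exact: iA.
have h2 : \int[mu]_(x in A) f x <= M * fine (mu A).
  rewrite -Rintegral_cst//; apply: le_Rintegral => //.
  by apply: iA; exact: bmf_integrable.
have h4 : fine (mu A) <= 0 by move: h1; rewrite h3 => h1; have := le_trans h1 h2; lra.
rewrite -[LHS]fineK ?fin_num_measure//; congr EFin; apply/eqP.
by rewrite eq_le h4 fine_ge0.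
Qed.

(** Replaces almost everywhere bounds by bounds at every point while keeping exact invariance of
    [h'], so that the rest of the proof deals with bounded functions only. The level sets of [h]
    beyond [M + 1] are invariant, hence null. *)
Lemma cond_exp_truncation (f h : Y -> R) :
  Linfty mu f -> is_cond_exp_inv mu T f h ->
  exists f' h' : Y -> R, [/\ bmf f', bmf h', forall x, h' (T x) = h' x,
    {ae mu, forall x, f x = f' x /\ h x = h' x} &
    forall A, invariant_sets T A -> \int[mu]_x (\1_A x * (f' x - h' x)) = 0].
Proof.
move=> [mf [M0 fM0]] [hinv [ih hfE]].
pose M := Num.max M0 0.
have M_ge0 : 0 <= M by rewrite /M le_max lexx orbT.
pose f' := truncate M f; pose h' := truncate (M + 1) h.
have mh : measurable_fun setT h.
  move=> _ B mB; rewrite setTI; exact: (hinv B mB).1.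
have bf' : bmf f' by exact: bmf_truncate.
have bh' : bmf h' by exact: bmf_truncate.
have aef : {ae mu, forall x, f x = f' x}.
  apply: filterS fM0 => x fx; rewrite /f' /truncate ifT//.
  by rewrite (le_trans fx)// /M le_max lexx.
have mEf : measurable_fun setT (EFin \o f) by exact: measurableT_comp.
have mEf' : measurable_fun setT (EFin \o f') by apply: measurableT_comp => //; exact: bf'.1.
have hf'E A : invariant_sets T A ->
    (\int[mu]_(x in A) (h x)%:E = \int[mu]_(x in A) (f' x)%:E)%E.
  move=> iA; rewrite (hfE A iA); apply: ae_eq_integral; first exact: iA.1.
  - exact: measurable_funTS.
  - exact: measurable_funTS.
  - by apply: filterS aef => x fx _ /=; rewrite fx.
have fM x : `|f' x| <= M by exact: norm_truncate.
have N1 : mu [set x | M + 1 < h x] = 0%E.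
  have iA : invariant_sets T [set x | M + 1 < h x].
    rewrite (_ : [set x | _] = h @^-1` `]M + 1, +oo[%classic); last first.
      by apply/seteqP; split => x /=; rewrite in_itv/= andbT.
    by apply: hinv; exact: measurable_itv.
  apply: (@cond_exp_bounded_above M f' h _ bf' _ ih iA.1 _ _) => [x| |].
  - by rewrite (le_trans (ler_norm _)).
  - by move=> x /ltW.
  - by rewrite /Rintegral hf'E.
have N2 : mu [set x | h x < - (M + 1)] = 0%E.
  have iA : invariant_sets T [set x | h x < - (M + 1)].
    rewrite (_ : [set x | _] = h @^-1` `]-oo, - (M + 1)[%classic); last first.
      by apply/seteqP; split => x /=; rewrite in_itv/=.
    by apply: hinv; exact: measurable_itv.
  apply: (@cond_exp_bounded_above M (fun x => - f' x) (fun x => - h x) _ (bmfN bf') _ _ iA.1).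
  - by move=> x; rewrite (le_trans (ler_norm _))// normrN.
  - exact: (integrableN ih).
  - by move=> x /= /ltW; rewrite lerNr.
  - under eq_Rintegral do rewrite -mulN1r.
    under [RHS]eq_Rintegral do rewrite -mulN1r.
    have mA := iA.1; rewrite !RintegralZl//; first by rewrite /Rintegral hf'E.
      by apply: (integrableS measurableT mA) => //; exact: bmf_integrable.
    exact: (integrableS measurableT mA).
have aeh : {ae mu, forall x, h x = h' x}.
  exists ([set x | M + 1 < h x] `|` [set x | h x < - (M + 1)]); split.
  - apply: measurableU; first exact: measurable_superlevel.
    exact: (measurable_ltr_set mh (measurable_cst _)).
  - rewrite measureU0//; first exact: measurable_superlevel.
    exact: (measurable_ltr_set mh (measurable_cst _)).
  - move=> x /=; rewrite /h' /truncate; case: ifP => // /negbT.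
    rewrite -ltNge ltr_normr => /orP[]; first by left.
    by rewrite ltrNr; right.
exists f', h'; split => //.
(* Applied to the singleton of the value [h x], the exact invariance of preimages gives
   [h (T x) = h x] at every point. *)
- move=> x; suff e : h (T x) = h x by rewrite /h' /truncate e.
  have [_ e] := hinv [set h x] (measurable_set1 _).
  have : (T @^-1` (h @^-1` [set h x])) x by rewrite e.
  by [].
- exact: filterS2 aef aeh.
- move=> A iA; have bA : bmf (\1_A : Y -> R) by apply: bmf_indic; exact: iA.1.
  under eq_Rintegral do rewrite mulrBr.
  rewrite (meanB _ (bmfM bA bf') (bmfM bA bh')) !mean_indicE; apply/eqP.
  rewrite subr_eq0 /Rintegral -(hf'E A iA); apply/eqP; congr fine.
  apply: ae_eq_integral; first exact: iA.1.
  - by apply: measurable_funTS; exact: measurableT_comp.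
  - by apply: measurable_funTS; apply: measurableT_comp => //; exact: bh'.1.
  - by apply: filterS aeh => x hx _ /=; rewrite hx.
Qed.

End TruncatedConditionalExpectation.

(** * Slowly varying weights *)

Section SlowWeights.
Variables (R : realType) (s : nat -> R) (e : nat -> bool).
Hypothesis s0 : forall n, 0 <= s n.
Hypothesis s1 : forall n, s n <= 1.
Hypothesis s_decr : forall n, s n.+1 <= s n.

(** Summation by parts in the form of an induction: the stronger claim [s N * sum q <= sum s q]
    survives because lowering the weight on a nonnegative partial sum only decreases it. *)
Lemma abel_sum_ge0 (q : nat -> R) N :
  (forall n, 0 <= \sum_(0 <= i < n) q i) -> 0 <= \sum_(0 <= n < N) s n * q n.
Proof.
move=> hq; suff h : s N * \sum_(0 <= i < N) q i <= \sum_(0 <= n < N) s n * q n.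
  by apply: le_trans h; rewrite mulr_ge0.
elim: N => [|N IH]; first by rewrite !big_geq// mulr0.
apply: (@le_trans _ _ (s N * \sum_(0 <= i < N.+1) q i)); first by rewrite ler_wpM2r.
by rewrite !big_nat_recr//= mulrDr lerD2r.
Qed.

Lemma weighted_average_le (q : nat -> R) (c : R) N :
  (forall n, \sum_(0 <= i < n) q i <= n%:R * c) ->
  \sum_(0 <= n < N) s n * q n <= c * \sum_(0 <= n < N) s n.
Proof.
move=> hq; rewrite -subr_ge0 mulr_sumr -sumrB.
under eq_bigr do rewrite [c * _]mulrC -mulrBr.
by apply: abel_sum_ge0 => n; rewrite sumrB sumr_const_nat subn0 -mulr_natl subr_ge0.
Qed.

(** Summation by parts: a shift by one moves the difference onto [u], leaving two boundary terms and
    the variation of [u]. *)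
Lemma shift_sum_le (u z : nat -> R) (K C : R) l N :
  (forall n, `|u n| <= K) -> (forall n, `|z n| <= C) ->
  `|\sum_(0 <= n < N) u n * z n - \sum_(0 <= n < N) u n * z (n + l)%N| <=
  l%:R * (C * (2 * K + \sum_(0 <= n < N) `|u n.+1 - u n|)).
Proof.
move=> hu; have K0 : 0 <= K by exact: le_trans (normr_ge0 _) (hu 0%N).
have step (y : nat -> R) : (forall n, `|y n| <= C) ->
    `|\sum_(0 <= n < N) u n * y n - \sum_(0 <= n < N) u n * y n.+1| <=
    C * (2 * K + \sum_(0 <= n < N) `|u n.+1 - u n|).
  move=> hy.
  have -> : \sum_(0 <= n < N) u n * y n - \sum_(0 <= n < N) u n * y n.+1 =
      u 0%N * y 0%N - u N * y N + \sum_(0 <= n < N) (u n.+1 - u n) * y n.+1.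
    elim: N => [|N IH]; first by rewrite !big_geq// subrr addr0 subrr.
    by rewrite !big_nat_recr//= opprD addrACA IH; ring.
  apply: (le_trans (ler_normD _ _)); rewrite mulrDr lerD//.
    apply: (le_trans (ler_normB _ _)); rewrite !normrM.
    have := ler_pM (normr_ge0 _) (normr_ge0 _) (hu 0%N) (hy 0%N).
    have := ler_pM (normr_ge0 _) (normr_ge0 _) (hu N) (hy N).
    move: (`|u N| * _) (`|u 0%N| * _) => p1 p2 h1 h2.
    by rewrite (_ : C * (2 * K) = K * C + K * C); [exact: lerD | ring].
  apply: (le_trans (ler_norm_sum _ _ _)); rewrite mulr_sumr.
  by apply: ler_sum_nat => n _; rewrite normrM mulrC ler_wpM2r.
elim: l z => [|l IH] z hz.
  by under [X in _ - X]eq_bigr do rewrite addn0; rewrite subrr normr0 mul0r.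
rewrite -natr1 mulrDl mul1r [leRHS]addrC.
have -> (p1 p2 : R) : p1 - p2 = (p1 - \sum_(0 <= n < N) u n * z n.+1) +
    (\sum_(0 <= n < N) u n * z n.+1 - p2) by ring.
apply: (le_trans (ler_normD _ _)); apply: lerD; first exact: step.
under [X in _ - X]eq_bigr do rewrite addnS -addSn.
exact: (IH (fun n => z n.+1)).
Qed.

(** The monotone factor [s] has total variation at most 1, and [phi] jumps only at selected times,
    by at most [2 * K], with weight [s]. The variation is thus governed by the sum of [s] over
    selected times. *)
Lemma variation_le (phi : nat -> R) (K : R) N :
  (forall n, `|phi n| <= K) -> (forall n, ~~ e n.+1 -> phi n.+1 = phi n) ->
  \sum_(0 <= n < N) `|s n.+1 * phi n.+1 - s n * phi n| <=
  K * (1 + 2 * (1 + \sum_(0 <= n < N) s n * (e n)%:R)).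
Proof.
move=> hphi he; have K0 : 0 <= K by exact: le_trans (normr_ge0 _) (hphi 0%N).
have se0 n : 0 <= s n * (e n)%:R by rewrite mulr_ge0.
have se1 n : s n * (e n)%:R <= 1.
  by case: (e n); rewrite ?mulr1 ?mulr0.
have term n : `|s n.+1 * phi n.+1 - s n * phi n| <=
    K * (s n - s n.+1) + K * (2 * (s n.+1 * (e n.+1)%:R)).
  have -> : s n.+1 * phi n.+1 - s n * phi n =
     s n.+1 * (phi n.+1 - phi n) - (s n - s n.+1) * phi n by ring.
  apply: (le_trans (ler_normB _ _)); rewrite addrC; apply: lerD.
    have d0 : 0 <= s n - s n.+1 by rewrite subr_ge0.
    by rewrite normrM mulrC (ger0_norm d0) ler_wpM2r.
  rewrite normrM (ger0_norm (s0 n.+1)); case en : (e n.+1).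
    rewrite mulr1 mulrA [leRHS]mulrC ler_wpM2l//.
    apply: (le_trans (ler_normB _ _)); rewrite mulr2n mulrDr mulr1.
    exact: lerD.
  by rewrite he ?en// subrr normr0 !mulr0.
apply: (le_trans (ler_sum_nat (fun n _ => term n))).
rewrite big_split/= -!mulr_sumr -mulrDr ler_wpM2l// lerD//.
  have -> : \sum_(0 <= n < N) (s n - s n.+1) = s 0%N - s N.
    elim: (N) => [|m IH]; first by rewrite big_geq// subrr.
    by rewrite big_nat_recr//= IH subrKA.
  by rewrite lerBlDr (le_trans (s1 0%N))// lerDl.
rewrite ler_wpM2l// -(big_add1 _ _ 0 N.+1 xpredT (fun n => s n * (e n)%:R)).
apply: (@le_trans _ _ (\sum_(0 <= n < N.+1) s n * (e n)%:R)).
  by rewrite [leRHS]big_ltn// lerDr.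
by rewrite big_nat_recr//= addrC lerD2r.
Qed.

Lemma weighted_sum_little_o (phi z : nat -> R) (K C : R) :
  (forall n, `|phi n| <= K) -> (forall n, ~~ e n.+1 -> phi n.+1 = phi n) ->
  (forall n, `|z n| <= C) ->
  little_o (fun N => \sum_(0 <= n < N) s n) (fun N => \sum_(0 <= n < N) s n * (e n)%:R) ->
  (forall eps : R, 0 < eps -> exists2 L, (0 < L)%N & forall n,
    \sum_(0 <= i < n) `|\sum_(0 <= l < L) z (i + l)%N| <= n%:R * (eps * L%:R)) ->
  little_o (fun N => \sum_(0 <= n < N) s n) (fun N => \sum_(0 <= n < N) s n * phi n * z n).
Proof.
move=> hphi he hz hE hL eps eps0.
have K0 : 0 <= K by exact: le_trans (normr_ge0 _) (hphi 0%N).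
have C0 : 0 <= C by exact: le_trans (normr_ge0 _) (hz 0%N).
have K1 : 0 < K + 1 by rewrite ltr_wpDl.
have e1 : 0 < eps / 2 / (K + 1) by rewrite !divr_gt0.
have [L L0 hL'] := hL _ e1.
have LR : 0 < L%:R :> R by rewrite ltr0n.
pose A := L%:R * (C * (2 * K)) + L%:R * (C * (K * 3)).
pose B := L%:R * (C * (K * 2)).
have B0 : 0 <= B by rewrite /B !mulr_ge0.
have B1 : 0 < B + 1 by rewrite ltr_wpDl.
have e2 : 0 < eps / 2 / (B + 1) by rewrite !divr_gt0.
have [D hD] := hE _ e2.
exists (A + B * D) => N.
pose u n := s n * phi n.
have hu n : `|u n| <= K.
  by rewrite /u normrM ger0_norm// -[leRHS]mul1r ler_pM.
set W := \sum_(0 <= n < N) s n.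
have W0 : 0 <= W by apply: sumr_ge0.
set E := \sum_(0 <= n < N) s n * (e n)%:R.
have hEN : E <= eps / 2 / (B + 1) * W + D.
  by apply: le_trans (ler_norm _) (hD N).
set X := \sum_(0 <= n < N) u n * z n.
pose TV := \sum_(0 <= n < N) `|u n.+1 - u n|.
have hTV : TV <= K * (1 + 2 * (1 + E)) by exact: variation_le.
(* Averaging over the shifts [l < L] replaces [z] by its block sums. The shift error is controlled
   by the variation of [u], which is small compared with [W] by [hE]; the block sums are small by
   [hL]. *)
pose Q := \sum_(0 <= n < N) u n * \sum_(0 <= l < L) z (n + l)%N.
have hQ : `|Q| <= K * (eps / 2 / (K + 1) * L%:R * W).
  apply: (le_trans (ler_norm_sum _ _ _)).
  apply: (@le_trans _ _ (K * \sum_(0 <= n < N) s n * `|\sum_(0 <= l < L) z (n + l)%N|)).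
    rewrite mulr_sumr; apply: ler_sum_nat => n _.
    rewrite /u !normrM ger0_norm// [s n * `|phi n|]mulrC -mulrA ler_wpM2r//.
    by rewrite mulr_ge0.
  by rewrite ler_wpM2l//; exact: weighted_average_le.
have hXQ : `|L%:R * X - Q| <= L%:R * (L%:R * (C * (2 * K + TV))).
  have -> : L%:R * X - Q = \sum_(0 <= l < L) (X - \sum_(0 <= n < N) u n * z (n + l)%N).
    rewrite sumrB sumr_const_nat subn0 mulr_natl; congr (_ - _).
    by rewrite exchange_big_nat/=; apply: eq_bigr => n _; rewrite mulr_sumr.
  apply: (le_trans (ler_norm_sum _ _ _)).
  rewrite [leRHS]mulr_natl -[X in _ *+ X]subn0 -sumr_const_nat.
  apply: ler_sum_nat => l /andP[_ lL].
  apply: (le_trans (shift_sum_le l N hu hz)); rewrite ler_wpM2r ?ler_nat 1?ltnW//.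
  rewrite mulr_ge0// addr_ge0 ?mulr_ge0//; exact: sumr_ge0.
have hX : L%:R * `|X| <= L%:R * (K * (eps / 2 / (K + 1) * W) + L%:R * (C * (2 * K + TV))).
  rewrite -{1}(gtr0_norm LR) -normrM -(subrK Q (L%:R * X)).
  apply: (le_trans (ler_normD _ _)); rewrite addrC mulrDr; apply: lerD => //.
  apply: (le_trans hQ); rewrite le_eqVlt; apply/orP; left; apply/eqP; ring.
rewrite ler_pM2l// in hX; apply: (le_trans hX).
have k1 : K * (eps / 2 / (K + 1) * W) <= eps / 2 * W.
  rewrite mulrA ler_wpM2r// mulrCA ler_piMr ?divr_ge0 ?(ltW eps0)//.
  by rewrite ler_pdivrMr// mul1r lerDl.
have k2 : L%:R * (C * (2 * K + TV)) <= A + B * E.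
  have -> : A + B * E = L%:R * (C * (2 * K + K * (1 + 2 * (1 + E)))).
    by rewrite /A /B; ring.
  by rewrite ler_wpM2l// ler_wpM2l// lerD2l.
have k3 : B * E <= eps / 2 * W + B * D.
  apply: (le_trans (ler_wpM2l B0 hEN)); rewrite mulrDr lerD2r mulrA ler_wpM2r//.
  rewrite mulrCA ler_piMr ?divr_ge0 ?(ltW eps0)//.
  by rewrite ler_pdivrMr// mul1r lerDl.
have -> : eps * W = eps / 2 * W + eps / 2 * W by field.
move: k1 k2 k3; move: (K * _) (L%:R * _) (B * E) (eps / 2 * W) (B * D) => *; lra.
Qed.

End SlowWeights.

(** * Small block averages along almost every orbit *)

Section WeightedErgodic.
Context {d : measure_display} {Y : measurableType d} {R : realType}.
Variables (mu : probability Y R) (S : Y -> Y).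
Hypothesis mpS : measure_preserving mu S.

Lemma ae_small_block_averages (h : Y -> R) : bmf h ->
  (forall A, invariant_sets S A -> \int[mu]_x (\1_A x * h x) = 0) ->
  {ae mu, forall x, forall eps : R, 0 < eps -> exists2 L, (0 < L)%N & forall n,
    \sum_(0 <= i < n) `|\sum_(0 <= l < L) h (iter (i + l).+1 S x)| <=
      n%:R * (eps * L%:R)}.
Proof.
move=> bh h0.
pose H L x := `|birkhoff_sum S h L x| / L%:R.
have bH L : bmf (H L).
  by apply: bmfM; [exact/bmf_norm/(bmf_birkhoff_sum mpS) | exact: bmf_cst].
have bHS L : bmf (fun x => H L (S x)) by exact: (bmf_T mpS).
have H0 L x : 0 <= H L (S x) by rewrite divr_ge0.
have main (j : nat) : {ae mu, forall x, exists2 L, (0 < L)%N &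
    forall n, birkhoff_sum S (fun x => H L (S x)) n x <= n%:R * j.+1%:R^-1}.
  have j0 : 0 < j.+1%:R^-1 :> R by rewrite invr_gt0 ltr0n.
  (* For fixed [j] the block length is chosen so that the mean of the block averages beats [j.+1^-1]
     by a factor [i.+1]; the maximal inequality then leaves an exceptional set of measure at most
     [i.+1^-1]. A point fails for all [i] only on a null set, and otherwise some [L], depending on
     the point, works. *)
  have ex i : exists LB : nat * set Y, [/\ (0 < LB.1)%N, measurable LB.2,
      (mu LB.2 <= (i.+1%:R^-1)%:E)%E & forall x n,
      n%:R * j.+1%:R^-1 < birkhoff_sum S (fun x => H LB.1 (S x)) n x -> LB.2 x].
    have eta0 : 0 < i.+1%:R^-1 * j.+1%:R^-1 :> R by rewrite mulr_gt0// invr_gt0 ltr0n.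
    have [L L0 hL] := mean_birkhoff_average_small mpS bh eta0 h0.
    have [B [mB muB hB]] := maximal_inequality mpS (bHS L) (H0 L) j0.
    exists (L, B); split => //=; apply: (le_trans muB); rewrite lee_fin.
    by rewrite (mean_comp mpS (bH L)) ler_pdivrMr.
  have /choice[LB hLB] := ex.
  exists (\bigcap_i (LB i).2); split.
  - by apply: bigcapT_measurable => i; have [] := hLB i.
  - apply/eqP; rewrite eq_le measure_ge0 andbT; apply/lee_addgt0Pr => r r0.
    rewrite add0e; pose i := Num.bound r^-1.
    have [_ mB muB _] := hLB i.
    apply: (@le_trans _ _ (mu (LB i).2)).
      apply: le_measure; rewrite ?inE//.
        by apply: bigcapT_measurable => k; have [] := hLB k.
      by move=> x; apply.
    apply: (le_trans muB); rewrite lee_fin -[leRHS]invrK lef_pV2 ?posrE ?invr_gt0 ?ltr0n//.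
    rewrite ltW//; apply: lt_trans (archi_boundP _) _; first by rewrite invr_ge0 ltW.
    by rewrite ltr_nat.
  - move=> x /= nx i _; have [L0 _ _ hB] := hLB i.
    apply: contrapT => nB; apply: nx; exists (LB i).1 => // n.
    by rewrite leNgt; apply/negP => /hB.
have := ae_foralln main.
apply: filterS => x hx eps eps0; pose j := Num.bound eps^-1.
have je : j.+1%:R^-1 <= eps.
  rewrite -[leRHS]invrK lef_pV2 ?posrE ?invr_gt0 ?ltr0n// ltW//.
  apply: lt_trans (archi_boundP _) _; first by rewrite invr_ge0 ltW.
  by rewrite ltr_nat.
have [L L0 hL] := hx j; exists L => // n.
have LR : 0 < L%:R :> R by rewrite ltr0n.
rewrite mulrA -ler_pdivrMr// mulr_suml.
apply: (@le_trans _ _ (n%:R * j.+1%:R^-1)); last by rewrite ler_wpM2l.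
apply: le_trans (hL n); rewrite le_eqVlt; apply/orP; left; apply/eqP.
apply: eq_bigr => i _; rewrite /H /birkhoff_sum; congr (`|_| / _).
by apply: eq_bigr => l _; rewrite -iterS -iterD addnS addnC.
Qed.

End WeightedErgodic.

(** * From a sparse sequence to all times *)

Lemma bounded_partial_sums_small (R : realType) (u : nat -> R) (C : R) :
  (forall k, 0 <= u k) -> (forall n, \sum_(0 <= k < n) u k <= C) ->
  forall eps : R, 0 < eps -> exists K, forall k, (K <= k)%N -> u k <= eps.
Proof.
move=> u0 uC eps eps0.
have c0 : u @ \oo --> (0 : R).
  apply: cvg_series_cvg_0; apply: nondecreasing_is_cvgn.
    apply/nondecreasing_seqP => n; rewrite /series/= big_nat_recr//= lerDl//.
  by exists C => _ [n _ <-]; exact: uC.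
have [K _ hK] := cvgr_le 0 c0 eps eps0.
by exists K => k Kk; apply: hK.
Qed.

(** Turns an almost everywhere statement whose content does not involve the point into a plain
    statement. *)
Lemma ae_exists d (Y : measurableType d) (R : realType) (mu : probability Y R)
  (Q : Y -> Prop) : {ae mu, forall x, Q x} -> exists x, Q x.
Proof.
move=> [N [mN N0 hN]]; apply: contrapT => nQ.
have NT : N = setT.
  by apply/seteqP; split => // x _; apply: hN => Qx; apply: nQ; exists x.
by have := probability_setT mu; rewrite -NT N0 => /eqP; rewrite eqe eq_sym oner_eq0.
Qed.

Section GapFilling.
Variables (R : realType) (a : R) (e : nat -> bool) (q : nat).
Hypothesis ha : 0 < a < 1 / 14.
Hypothesis q0 : (0 < q)%N.

Let a0 : 0 < a. Proof. by case/andP: ha. Qed.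
Let W := total a.
Let node k := (k.+1 ^ q)%N.

Lemma total_ge0 N : 0 <= W N.
Proof. by apply: sumr_ge0 => n _; exact/ltW/density_gt0. Qed.

Lemma total_mono M N : (M <= N)%N -> W M <= W N.
Proof.
move=> MN; rewrite /W /total (big_cat_nat (leq0n M) MN)/= lerDl.
by apply: sumr_ge0 => n _; exact/ltW/density_gt0.
Qed.

Lemma total_unbounded (K : nat) : exists N, K%:R <= W N.
Proof.
have [->|K0] := posnP K; first by exists 0%N; exact: total_ge0.
(* At [N = K ^ 2] the lower bound [N^(1-a)] exceeds [N^(1/2) = K]. *)
have N0 : (0 < K ^ 2)%N by rewrite expn_gt0 K0.
exists (K ^ 2)%N; apply: le_trans (total_ge (ltW a0) N0).
have NR : 0 < (K ^ 2)%:R :> R by rewrite ltr0n.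
rewrite ler_pdivlMr ?powR_gt0//.
apply: (@le_trans _ _ (K%:R * (K ^ 2)%:R `^ (1 / 2))).
  by rewrite ler_wpM2l// ler_powR ?ler1n//; case/andP: ha => _; lra.
have -> : (K ^ 2)%:R `^ (1 / 2) = K%:R :> R.
  by rewrite natrX mul1r -powR_mulrn// -powRrM mulfV// powRr1.
by rewrite natrX expr2.
Qed.

Lemma density_small (eps : R) : 0 < eps -> exists n0, forall n, (n0 <= n)%N ->
  density a n <= eps.
Proof.
move=> eps0; pose b := eps^-1 `^ a^-1.
have b0 : 0 < b by rewrite powR_gt0// invr_gt0.
exists (Num.bound b) => n hn.
rewrite /density powRN -[leRHS]invrK lef_pV2 ?posrE ?invr_gt0 ?powR_gt0//.
have -> : eps^-1 = b `^ a by rewrite /b -powRrM mulVf ?gt_eqF// powRr1// invr_ge0 ltW.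
apply: ge0_ler_powR; rewrite ?nnegrE ?ltW//.
by apply: lt_trans (archi_boundP (ltW b0)) _; rewrite ltr_nat.
Qed.

(** The densities decrease, so [W] grows at most in proportion to [N], and the ratio of consecutive
    nodes is (1 + 1/(k+1))^q, which tends to 1. This is why the nodes are polynomial rather than
    geometric. *)
Lemma total_ratio (eps : R) : 0 < eps -> exists K, forall k, (K <= k)%N ->
  W (node k.+1) <= (1 + eps) * W (node k).
Proof.
move=> eps0.
have c0 : (fun k => 1 + harmonic k : R) @ \oo --> (1 : R).
  by rewrite -[X in _ --> X]addr0; apply: cvgD; [exact: cvg_cst | exact: cvg_harmonic].
have c1 : (fun k => (1 + harmonic k) ^+ q : R) @ \oo --> (1 : R).
  rewrite -[X in _ --> X](expr1n R q).
  exact: (cvg_comp (fun k => 1 + harmonic k : R) (fun x => x ^+ q) c0 (@exprn_continuous R q 1)).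
have e1 : 1 < 1 + eps by rewrite ltrDl.
have [K _ hK] := cvgr_le 1 c1 _ e1.
exists K => k Kk; have := hK k Kk; rewrite /= => hk.
have N0 : (0 < node k)%N by rewrite expn_gt0.
have NN : (node k <= node k.+1)%N by rewrite leq_exp2r.
apply: le_trans (ler_wpM2r (total_ge0 _) hk).
have -> : (1 + harmonic k) ^+ q = (node k.+1)%:R / (node k)%:R :> R.
  rewrite /node !natrX -expr_div_n /harmonic/=; congr (_ ^+ q).
  by rewrite -[k.+2%:R]natr1; field; rewrite gt_eqF.
rewrite mulrAC ler_pdivlMr ?ltr0n//.
have h1 : W (node k.+1) <= W (node k) + (node k.+1 - node k)%:R * density a (node k).
  rewrite /W /total (big_cat_nat (leq0n _) NN)/= lerD2l mulr_natl -sumr_const_nat.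
  by apply: ler_sum_nat => n /andP[hn _]; exact: (density_le (ltW a0) hn).
have h2 : (node k)%:R * density a (node k) <= W (node k).
  rewrite mulr_natl -[X in _ *+ X]subn0 -sumr_const_nat.
  by apply: ler_sum_nat => n /andP[_ hn]; exact: (density_le (ltW a0) (ltnW hn)).
apply: (le_trans (ler_wpM2r (ler0n _ _) h1)).
rewrite natrB// in h1 *; have d0 : 0 <= (node k.+1)%:R - (node k)%:R :> R.
  by rewrite subr_ge0 ler_nat.
move: (ler_wpM2l d0 h2); move: (W _) (density _ _) (_%:R) (_%:R) => p1 p2 p3 p4; lra.
Qed.

Lemma node_between N : (0 < N)%N -> exists k, (node k <= N < node k.+1)%N.
Proof.
move=> N0; have ex : exists k, (N < node k)%N.
  exists N; apply: (@leq_trans (N.+1 ^ 1)%N); first by rewrite expn1.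
  by rewrite leq_exp2l.
have := ex_minnP ex; case=> [[|k] hk min].
  by move: hk; rewrite /node exp1n ltnS leqNgt N0.
by exists k; rewrite hk andbT leqNgt; apply/negP => /min; rewrite ltnn.
Qed.

(** The monotone majorant [c] bounds the oscillation of [s] between nodes. As [c] is close to
    [2 * W] at both ends of a gap and [W] barely grows there, that oscillation is small. *)
Lemma sparse_little_o (s c : nat -> R) :
  (forall M N, (M <= N)%N -> `|s N - s M| <= c N - c M) ->
  (forall eps : R, 0 < eps -> exists K, forall k, (K <= k)%N ->
     `|s (node k)| <= eps * W (node k)) ->
  (forall eps : R, 0 < eps -> exists K, forall k, (K <= k)%N ->
     `|c (node k) - 2 * W (node k)| <= eps * W (node k)) ->
  little_o W s.
Proof.
move=> hsc hs hc eps eps0.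
have [r r0 [r1 r8]] : exists2 r : R, 0 < r & r <= 1 /\ 8 * r <= eps.
  exists (Num.min 1 (eps / 8)); first by rewrite lt_min ltr01 divr_gt0.
  split; first by rewrite ge_min lexx.
  by rewrite -ler_pdivlMl// mulrC ge_min lexx orbT.
have [K1 h1] := hs _ r0; have [K2 h2] := hc _ r0; have [K3 h3] := total_ratio r0.
pose K := maxn K1 (maxn K2 K3).
exists (`|s 0%N| + (c (node K) - c 0%N)) => N.
have cmono M M' : (M <= M')%N -> c M <= c M'.
  by move=> MM; rewrite -subr_ge0; apply: le_trans (hsc _ _ MM).
have [NK|KN] := leqP N (node K).
  rewrite -[leLHS]add0r; apply: lerD; first by apply: mulr_ge0; [exact: ltW | exact: total_ge0].
  rewrite -(subrK (s 0%N) (s N)) addrC; apply: (le_trans (ler_normD _ _)).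
  rewrite lerD2l; apply: (le_trans (hsc _ _ (leq0n N))).
  by rewrite lerB// cmono.
rewrite -[leLHS]addr0; apply: lerD; last first.
  by rewrite addr_ge0// subr_ge0 cmono.
have N0 : (0 < N)%N by exact: leq_ltn_trans KN.
have [k /andP[kN Nk]] := node_between N0.
have Kk : (K <= k)%N.
  rewrite leqNgt; apply/negP => kK; have : (node k.+1 <= node K)%N by rewrite leq_exp2r.
  by rewrite leqNgt (ltn_trans KN Nk).
have K1k : (K1 <= k)%N by rewrite (leq_trans _ Kk)// leq_maxl.
have K2k : (K2 <= k)%N by rewrite (leq_trans _ Kk)// leq_max leq_maxl orbT.
have K3k : (K3 <= k)%N by rewrite (leq_trans _ Kk)// !leq_max leqnn !orbT.
have := h1 k K1k; have := h2 k K2k; have := h2 k.+1 (leqW K2k); have := h3 k K3k.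
set w := W (node k); set w' := W (node k.+1); set p := c (node k); set p' := c (node k.+1).
move=> ww /ler_normlP[_ g1] /ler_normlP[g2 _] g3.
have w0 : 0 <= w by exact: total_ge0.
have sN : `|s N| <= r * w + (p' - p).
  rewrite -(subrK (s (node k)) (s N)) addrC; apply: (le_trans (ler_normD _ _)).
  apply: lerD => //; apply: (le_trans (hsc _ _ kN)).
  by rewrite lerB// cmono// ltnW.
(* The errors add up to at most [6 * r * w]: [r * w] from [s] at the node, [2 * r * w] from the
   growth of [2 * W], and [2 * r * w] and [r * w] from [c] at the two ends. *)
apply: (le_trans sN); apply: (@le_trans _ _ (8 * r * w)); last first.
  by apply: ler_pM => //; [apply: mulr_ge0 => //; exact: ltW | exact: total_mono].
have rw : r * w' <= r * w + r * w.
  rewrite -mulrDr ler_wpM2l ?(ltW r0)//; apply: (le_trans ww).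
  by rewrite mulrDl mul1r lerD2l ler_piMl.
have rw0 : 0 <= r * w by apply: mulr_ge0 => //; exact: ltW.
move: ww g1 g2 rw rw0; rewrite mulrDl mul1r -mulrA; clear.
move: (r * w) (r * w') => *; lra.
Qed.

(** The average of the theorem before division, indexed by time: at a selected time the first
    argument is its rank [n], the second is [a_n]. *)
Definition cnt_sum (F : nat -> nat -> R) k : R :=
  \sum_(0 <= i < k) (e i)%:R * F (cnt e 0 i.+1) i.+1.

Let y := centered (density a) e.

Lemma cntR k : (cnt e 0 k)%:R = \sum_(0 <= i < k) (e i)%:R :> R.
Proof. by rewrite /cnt natr_sum. Qed.

(** Each increment is at most [e n + density a n], which makes [cnt + W] the majorant required by
    [sparse_little_o]; hence the factor 2 in its hypothesis. *)
Lemma sum_centered_control (v : nat -> R) : (forall n, `|v n| <= 1) ->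
  forall M N, (M <= N)%N ->
  `|\sum_(0 <= n < N) y n * v n - \sum_(0 <= n < M) y n * v n| <=
  ((cnt e 0 N)%:R + W N) - ((cnt e 0 M)%:R + W M).
Proof.
move=> v1 M N MN.
have cut (F : nat -> R) : \sum_(0 <= n < N) F n - \sum_(0 <= n < M) F n =
    \sum_(M <= n < N) F n.
  by rewrite (big_cat_nat (leq0n M) MN)/= addrAC subrr add0r.
rewrite !cntR /W /total -!big_split/= !cut.
apply: (le_trans (ler_norm_sum _ _ _)); apply: ler_sum_nat => n _.
rewrite normrM -[leRHS]mulr1; apply: ler_pM => //.
by rewrite (le_trans (ler_normB _ _))// !ger0_norm ?(ltW (density_gt0 _ _)).
Qed.

Section System.
Context {d : measure_display} {Y : measurableType d}.
Variables (mu : probability Y R).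
Hypothesis he : controlled a q e.

Let y1 n : `|y n| <= 1.
Proof.
by apply: norm_centered => m; rewrite (ltW (density_gt0 _ _)) density_le1// ltW.
Qed.

Let Wnode0 k : 0 < W (node k).
Proof.
have N0 : (0 < node k)%N by rewrite expn_gt0.
apply: lt_le_trans (total_ge (ltW a0) N0).
by rewrite divr_gt0 ?ltr0n// powR_gt0// ltr0n.
Qed.

(** [controlled] bounds the sum over [k] of the squared L^2 norms divided by [W (node k) ^+ 2], so
    almost surely these normalized squares tend to 0. *)
Lemma ae_centered_sum_small (T S : Y -> Y) (f g : Y -> R) :
  measure_preserving mu T -> measure_preserving mu S -> T \o S = S \o T ->
  bmf f -> bmf g -> (forall x, `|f x| <= 1) -> (forall x, `|g x| <= 1) ->
  {ae mu, forall x, forall eps : R, 0 < eps -> exists K, forall k, (K <= k)%N ->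
    `|\sum_(0 <= n < node k) y n * (f (iter (cnt e 0 n.+1) T x) * g (iter n.+1 S x))|
      <= eps * W (node k)}.
Proof.
move=> mT mS TS bf bg f1 g1.
have [M [M' [l [l' [C [hpos hC]]]]]] := he.
pose s k x := \sum_(0 <= n < node k) y n * (f (iter (cnt e 0 n.+1) T x) * g (iter n.+1 S x)).
have bs k : bmf (s k).
  by apply: bmf_sum => n _; apply: bmfZ; apply: bmfM; [exact: (bmf_iter _ mT bf) | exact: (bmf_iter _ mS bg)].
pose u k x := (W (node k) ^+ 2)^-1 * s k x ^+ 2.
have bu k : bmf (u k) by apply: bmfZ; exact: bmf_sqr.
have u0 k x : 0 <= u k x by rewrite mulr_ge0 ?invr_ge0 ?sqr_ge0.
have Eu n : \sum_(0 <= k < n) \int[mu]_x u k x <= C.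
  apply: le_trans (hC n); apply: ler_sum_nat => k _.
  rewrite (meanZ _ _ (bmf_sqr (bs k))) mulrC ler_wpM2r ?invr_ge0 ?sqr_ge0//.
  have [M0 M'0 l0 l'0] := hpos k.
  exact: (mean_commuting_sum_le mT mS TS e y1 (node k) M0 M'0 l0 l'0 bf bg f1 g1).
apply: filterS (ae_bounded_partial_sums bu u0 Eu) => x [D hD] eps eps0.
have e2 : 0 < eps ^+ 2 by rewrite exprn_gt0.
have [K hK] := bounded_partial_sums_small (u0^~ x) hD e2.
exists K => k Kk; have := hK k Kk; rewrite /u mulrC ler_pdivrMr ?exprn_gt0//.
rewrite -exprMn -[leLHS]real_normK ?num_real// ler_sqr ?nnegrE//.
by rewrite mulr_ge0 ?(ltW eps0) ?(ltW (Wnode0 k)).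
Qed.

(** The law of large numbers for the count is the same estimate with identity maps and constant
    functions 1. The sum no longer depends on the point, so one point of the conull set suffices. *)
Lemma count_small_at_nodes (eps : R) : 0 < eps -> exists K, forall k, (K <= k)%N ->
  `|(cnt e 0 (node k))%:R + W (node k) - 2 * W (node k)| <= eps * W (node k).
Proof.
move=> eps0; have mid : measure_preserving mu idfun by split => //; exact: measurable_id.
have b1 : bmf (fun _ : Y => 1 : R) by exact: bmf_cst.
have n1 (x : Y) : `|1 : R| <= 1 by rewrite normr1.
have := ae_centered_sum_small mid mid erefl b1 b1 n1 n1.
move=> /ae_exists[x /(_ eps eps0)[K hK]].
exists K => k Kk; have := hK k Kk; congr (`|_| <= _).
under eq_bigr do rewrite mulr1 mulr1.
by rewrite /y /centered sumrB -cntR /W /total; ring.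
Qed.

End System.
End GapFilling.

Lemma cnt_sum_const_reindex (R : realType) (e : nat -> bool) (F : nat -> R) N :
  cnt_sum e (fun n _ => F n) N = \sum_(1 <= n < (cnt e 0 N).+1) F n.
Proof.
elim: N => [|N IH]; first by rewrite /cnt_sum /cnt !big_geq.
rewrite /cnt_sum big_nat_recr//= -/(cnt_sum e (fun n _ => F n) N) IH.
have cE := cntS e N.
case eN : (e N); rewrite eN in cE; last by rewrite cE addn0 mul0r addr0.
by rewrite mul1r cE addn1 [RHS]big_nat_recr.
Qed.

Lemma cnt_sum_reindex (R : realType) (e : nat -> bool) (pos : nat -> nat)
  (F : nat -> nat -> R) N : (forall i, e i -> pos (cnt e 0 i.+1) = i.+1) ->
  cnt_sum e F N = \sum_(1 <= n < (cnt e 0 N).+1) F n (pos n).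
Proof.
move=> hpos; rewrite -(cnt_sum_const_reindex e (fun n => F n (pos n))).
apply: eq_bigr => i _; case ei : (e i); last by rewrite !mul0r.
by rewrite hpos.
Qed.

(** * Limits of the averages for a fixed good omega *)

Section Assembly.
Variables (R : realType) (a : R) (e : nat -> bool) (q : nat).
Hypothesis ha : 0 < a < 1 / 14.
Hypothesis q0 : (0 < q)%N.
Hypothesis he : controlled a q e.
Context {d : measure_display} {Y : measurableType d}.
Variables (mu : probability Y R) (T S : Y -> Y).
Hypothesis mT : measure_preserving mu T.
Hypothesis mS : measure_preserving mu S.
Hypothesis TS : T \o S = S \o T.

Let a0 : 0 <= a. Proof. by apply: ltW; case/andP: ha. Qed.
Let W := total a.
Let W0 N : 0 <= W N. Proof. exact: total_ge0. Qed.
Let y := centered (density a) e.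

Lemma count_little_o : little_o W (fun N => (cnt e 0 N)%:R - W N).
Proof.
apply: (sparse_little_o ha q0 (c := fun N => (cnt e 0 N)%:R + W N)).
- move=> M N MN.
  have := @sum_centered_control _ a e (fun=> 1) _ M N MN.
  rewrite normr1 => /(_ (fun=> lexx 1)); congr (_ <= _); congr (`|_|).
  under eq_bigr do rewrite mulr1.
  under [X in _ - X]eq_bigr do rewrite mulr1.
  by rewrite /centered !sumrB -!cntR.
- move=> eps eps0; have [K hK] := count_small_at_nodes ha mu he eps0.
  exists K => k Kk; have := hK k Kk; congr (`|_| <= _); rewrite /W; ring.
- by move=> eps eps0; exact: (count_small_at_nodes ha mu he eps0).
Qed.

Lemma total_le_count : exists C : R, forall N, W N <= 2 * (cnt e 0 N)%:R + C.
Proof.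
have h : 0 < 1 / 2 :> R by lra.
have [C hC] := count_little_o h; exists (2 * C) => N.
have /ler_normlP[h1 _] := hC N; move: h1; move: (W N) (_%:R) => p1 p2; lra.
Qed.

Lemma count_le_total : exists C : R, forall N, (cnt e 0 N)%:R <= 2 * W N + C.
Proof.
have [C hC] := count_little_o ltr01; exists C => N.
have /ler_normlP[_ h1] := hC N; move: h1; move: (W N) (_%:R) => p1 p2; lra.
Qed.

(** From some [n0] on the density is below [eps / 2], and the count is at most about [2 * W]; the
    first [n0] terms go into the constant. This makes the weights vary slowly. *)
Lemma weighted_count_little_o :
  little_o W (fun N => \sum_(0 <= n < N) density a n * (e n)%:R).
Proof.
move=> eps eps0; have e2 : 0 < eps / 2 by lra.
have [C hC] := count_le_total; have [n0 hn0] := density_small ha e2.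
exists (n0%:R + eps / 2 * C) => N.
rewrite ger0_norm; last first.
  by apply: sumr_ge0 => n _; rewrite mulr_ge0 ?(ltW (density_gt0 _ _)).
apply: (@le_trans _ _ (n0%:R + eps / 2 * (cnt e 0 N)%:R)); last first.
  have := ler_wpM2l (ltW e2) (hC N); rewrite mulrDr mulrA divfK//.
  by move=> h; rewrite addrCA lerD2l.
apply: (@le_trans _ _ (\sum_(0 <= n < N) ((n < n0)%N%:R + eps / 2 * (e n)%:R))).
  apply: ler_sum_nat => n _; case: ltnP => nn0; last first.
    by rewrite add0r ler_wpM2r// hn0.
  apply: (@le_trans _ _ 1); last by rewrite lerDl mulr_ge0// ltW.
  case: (e n); rewrite ?mulr0 ?mulr1 ?ler01//; exact: density_le1.
rewrite big_split/= -mulr_sumr -(@cntR R e N) lerD2r -natr_sum ler_nat.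
elim: N => [|N IH]; first by rewrite big_geq.
rewrite big_nat_recr//=; case: (ltnP N n0) => Nn0; last by rewrite addn0.
rewrite addn1; apply: leq_trans Nn0; rewrite ltnS.
rewrite -[X in (_ <= X)%N]subn0 -[X in (_ <= X)%N]muln1 -sum_nat_const_nat.
by apply: leq_sum => i _; exact: leq_b1.
Qed.

Lemma count_unbounded m : exists k, (m <= cnt e 0 k)%N.
Proof.
have [C hC] := total_le_count.
have [N hN] := total_unbounded ha (2 * m + Num.bound C).
exists N; rewrite -(ler_nat R); have := hC N.
have Cb : C <= (Num.bound C)%:R.
  have [C0|C0] := leP 0 C; first exact: (ltW (archi_boundP C0)).
  by rewrite (le_trans (ltW C0)).
by rewrite natrD natrM -/W in hN; move=> h; lra.
Qed.

Lemma ae_centered_little_o (f g : Y -> R) : bmf f -> bmf g ->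
  {ae mu, forall x, little_o W (fun N => \sum_(0 <= n < N)
    y n * (f (iter (cnt e 0 n.+1) T x) * g (iter n.+1 S x)))}.
Proof.
move=> bf bg; have [mf [C1 hC1]] := bf; have [mg [C2 hC2]] := bg.
pose C := `|C1| + `|C2| + 1.
have C0 : 0 < C by rewrite ltr_wpDl// addr_ge0.
have fC x : `|f x| <= C.
  apply: (le_trans (hC1 x)); apply: (le_trans (ler_norm _)).
  by rewrite /C -addrA lerDl addr_ge0.
have gC x : `|g x| <= C.
  apply: (le_trans (hC2 x)); apply: (le_trans (ler_norm _)).
  by rewrite /C addrAC lerDr addr_ge0.
have n1 (u : Y -> R) : (forall x, `|u x| <= C) -> forall x, `|C^-1 * u x| <= 1.
  move=> uC x; rewrite normrM gtr0_norm ?invr_gt0// mulrC ler_pdivrMr// mul1r.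
  exact: uC.
have := ae_centered_sum_small ha he mT mS TS (bmfZ C^-1 bf) (bmfZ C^-1 bg)
  (n1 _ fC) (n1 _ gC).
apply: filterS => x hx.
pose v n := C^-1 * f (iter (cnt e 0 n.+1) T x) * (C^-1 * g (iter n.+1 S x)).
have v1 n : `|v n| <= 1 by rewrite normrM mulr_ile1 ?n1.
have h := sparse_little_o ha q0 (sum_centered_control a e v1) hx
  (fun eps eps0 => count_small_at_nodes ha mu he eps0).
apply: eq_little_o (little_oZ W0 (C ^+ 2) h) => N.
rewrite mulr_sumr; apply: eq_bigr => n _; rewrite /v.
by rewrite mulrCA expr2 mulrACA !mulVKf ?gt_eqF.
Qed.

Lemma ae_cnt_sum_little_o (f g ft gt : Y -> R) :
  bmf f -> bmf ft -> (forall x, ft (T x) = ft x) ->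
  (forall A, invariant_sets T A -> \int[mu]_x (\1_A x * (f x - ft x)) = 0) ->
  bmf g -> bmf gt -> (forall x, gt (S x) = gt x) ->
  (forall A, invariant_sets S A -> \int[mu]_x (\1_A x * (g x - gt x)) = 0) ->
  {ae mu, forall x, little_o W (fun N =>
     cnt_sum e (fun m k => f (iter m T x) * g (iter k S x)) N - W N * (ft x * gt x))}.
Proof.
move=> bf bft ftT hf bg bgt gtS hg.
have H1 := ae_centered_little_o bf bg.
have H2 := ae_centered_little_o bf (bmf_cst (1 : R)).
have H3 := birkhoff_ae mT (bmfB bf bft) hf.
have H4 := ae_small_block_averages mS (bmfB bg bgt) hg.
apply: filterS2 (filterI H1 H2) (filterI H3 H4) => x [h1 h2] [h3 h4].
have [_ [Cf hCf]] := bf; have [_ [Ch hCh]] := bmfB bg bgt.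
have ftn n : ft (iter n T x) = ft x by elim: n => //= n <-.
have gtn n : gt (iter n S x) = gt x by elim: n => //= n <-.
have h5 : little_o W (fun N => \sum_(0 <= n < N) density a n *
    f (iter (cnt e 0 n.+1) T x) * (g (iter n.+1 S x) - gt (iter n.+1 S x))).
  apply: (@weighted_sum_little_o _ _ e _ _ _ _ _ Cf Ch) => //.
  - by move=> n; exact/ltW/density_gt0.
  - by move=> n; exact: density_le1.
  - by move=> n; exact: density_le.
  - move=> n /negbTE en; rewrite (cnt_cat e (leq0n n.+1) (leqnSn _)).
    by rewrite {2}/cnt big_nat1 en addn0.
  - exact: weighted_count_little_o.
have h6 : little_o W (fun N => cnt_sum e (fun m _ => f (iter m T x)) N - W N * ft x).
  have h7 : little_o W (fun N => cnt_sum e (fun m _ => f (iter m T x)) N -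
      (cnt e 0 N)%:R * ft x).
    move=> eps eps0; have e2 : 0 < eps / 2 by lra.
    have [K hK] := h3 _ e2; have [C hC] := count_le_total.
    exists (eps / 2 * (C + 1) + K + `|f x - ft x|) => N.
    rewrite [cnt_sum _ _ _]cnt_sum_const_reindex.
    (* The sum runs over [1 <= n], the Birkhoff sum starts at 0: hence length [cnt + 1] and the
       subtraction of the initial term. *)
    have -> : \sum_(1 <= n < (cnt e 0 N).+1) f (iter n T x) - (cnt e 0 N)%:R * ft x =
        birkhoff_sum T (fun x => f x - ft x) (cnt e 0 N).+1 x - (f x - ft x).
      rewrite /birkhoff_sum [X in _ = X - _]big_ltn//= addrAC subrr add0r sumrB; congr (_ - _).
      under eq_bigr do rewrite ftn.
      by rewrite sumr_const_nat subn1 mulr_natl.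
    apply: (le_trans (ler_normB _ _)); rewrite 2![in leRHS]addrA lerD2r.
    apply: (le_trans (hK _)); rewrite lerD2r -[(cnt e 0 N).+1%:R]natr1.
    have := ler_wpM2l (ltW e2) (hC N); rewrite mulrDr mulrA divfK// => h.
    by rewrite mulrDr [in leRHS]mulrDr mulr1 addrA lerD2r.
  apply: eq_little_o (little_oD h7 (little_oZ W0 (ft x) count_little_o)) => N; ring.
apply: eq_little_o (little_oD (little_oD h1 h5)
  (little_oZ W0 (gt x) (little_oB W0 h6 h2))) => N.
(* Writing [e = y + density] and [g = gt + (g - gt)], the remaining piece is [gt x] times the
   density-weighted sum of [f], which is converted back into a sum over selected times with the help
   of [h2]. *)
have -> : cnt_sum e (fun m k => f (iter m T x) * g (iter k S x)) N =
    \sum_(0 <= n < N) y n * (f (iter (cnt e 0 n.+1) T x) * g (iter n.+1 S x)) +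
    \sum_(0 <= n < N) density a n * f (iter (cnt e 0 n.+1) T x) * (g (iter n.+1 S x) - gt (iter n.+1 S x)) +
    gt x * (cnt_sum e (fun m _ => f (iter m T x)) N -
      \sum_(0 <= n < N) y n * (f (iter (cnt e 0 n.+1) T x) * 1)).
  rewrite /cnt_sum -sumrB mulr_sumr -!big_split/=; apply: eq_bigr => n _.
  by rewrite -(gtn n.+1) /y /centered iterS; ring.
ring.
Qed.

(** The estimate is read off at [N = pos m], where the count is exactly [m] and [W] is at most
    [2 * m] plus a constant. *)
Lemma cnt_sum_little_o_index (F : nat -> nat -> R) (c : R) (pos : nat -> nat) :
  (forall m, cnt e 0 (pos m) = m) -> (forall i, e i -> pos (cnt e 0 i.+1) = i.+1) ->
  little_o W (fun N => cnt_sum e F N - W N * c) ->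
  little_o (fun n => n%:R) (fun m => \sum_(1 <= n < m.+1) F n (pos n) - m%:R * c).
Proof.
move=> hpos hpos' hF.
have hG : little_o W (fun N => cnt_sum e F N - (cnt e 0 N)%:R * c).
  apply: eq_little_o (little_oB W0 hF (little_oZ W0 c count_little_o)) => N; ring.
move=> eps eps0; have e2 : 0 < eps / 2 by lra.
have [K hK] := hG _ e2; have [C hC] := total_le_count.
exists (eps / 2 * C + K) => m; have := hK (pos m).
rewrite (cnt_sum_reindex _ _ hpos') hpos => h; apply: (le_trans h).
have := ler_wpM2l (ltW e2) (hC (pos m)); rewrite hpos mulrDr mulrA divfK// => h'.
by rewrite addrA lerD2r.
Qed.

End Assembly.

(** * The random sequence *)

(** The preimages of a null set under all iterates are null. This transfers the truncations to whole
    orbits, in particular to the irregular times [a_n]. *)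
Lemma ae_comp_iter d (Y : measurableType d) (R : realType) (mu : probability Y R)
  (T : Y -> Y) (Q : Y -> Prop) : measure_preserving mu T ->
  {ae mu, forall x, Q x} -> {ae mu, forall x, forall n, Q (iter n T x)}.
Proof.
move=> mT [N [mN N0 hN]]; apply: ae_foralln => n.
have [mi pi] := measure_preserving_iter n mT.
exists (iter n T @^-1` N); split.
- by rewrite -[_ @^-1` _]setTI; exact: mi.
- by rewrite -N0; exact: pi.
- by move=> x /= nQ; exact: hN.
Qed.

Section RandomSequence.
Variables (R : realType) (Omega : Type) (X : nat -> Omega -> R) (w : Omega).
Hypothesis X01 : forall i, X i.+1 w = 1 \/ X i.+1 w = 0.

Definition selected (i : nat) : bool := X i.+1 w == 1.

Lemma partial_countE k : partial_count X w k = (cnt selected 0 k)%:R.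
Proof.
rewrite /partial_count big_add1/= cntR; apply: eq_bigr => i _.
by rewrite /selected; case: (X01 i) => ->; rewrite ?eqxx// eq_sym oner_eq0.
Qed.

Lemma cnt_mono i j : (i <= j)%N -> (cnt selected 0 i <= cnt selected 0 j)%N.
Proof. by move=> ij; rewrite (cnt_cat _ (leq0n i) ij) leq_addr. Qed.

Hypothesis unbounded : forall m, exists k, (m <= cnt selected 0 k)%N.

(** The count starts at 0 and rises by at most one per step, so the first time it reaches [m] it
    equals [m]. Existence of such a time excludes the default value of [xget]. *)
Lemma rand_seq_spec m : cnt selected 0 (rand_seq X w m) = m /\
  forall j, (j < rand_seq X w m)%N -> (cnt selected 0 j < m)%N.
Proof.
have [k mk hk] := ex_minnP (unbounded m).
have hlt j : (j < k)%N -> (cnt selected 0 j < m)%N.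
  by move=> jk; rewrite ltnNge; apply/negP => /hk; rewrite leqNgt jk.
have ck : cnt selected 0 k = m.
  apply/eqP; rewrite eqn_leq mk andbT; case: k mk hk hlt => [|k] mk hk hlt.
    by rewrite /cnt big_geq.
  rewrite cntS; apply: leq_trans (hlt k (ltnSn k)).
  by rewrite -addn1 leq_add2l leq_b1.
have : [set k | partial_count X w k = m%:R /\
    forall j, (j < k)%N -> partial_count X w j <> m%:R] (rand_seq X w m).
  apply: (@xgetPex _ 0%N); exists k; split; first by rewrite partial_countE ck.
  move=> j /hlt jm; rewrite partial_countE => /eqP.
  by rewrite eqr_nat => /eqP jE; rewrite jE ltnn in jm.
move=> [/eqP]; rewrite partial_countE eqr_nat => /eqP h1 h2; split => // j jr.
have := cnt_mono (ltnW jr); rewrite h1 leq_eqVlt => /orP[/eqP e|//].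
by have := h2 j jr; rewrite partial_countE e.
Qed.

Lemma rand_seq_selected i : selected i -> rand_seq X w (cnt selected 0 i.+1) = i.+1.
Proof.
move=> si; set m := cnt _ _ _; have [h1 h2] := rand_seq_spec m.
have im : (cnt selected 0 i < m)%N by rewrite /m cntS si addn1.
apply/eqP; rewrite eqn_leq; apply/andP; split; rewrite leqNgt; apply/negP.
  by move=> /h2; rewrite -/m ltnn.
by rewrite ltnS => /cnt_mono; rewrite h1 leqNgt im.
Qed.

End RandomSequence.

(** * Cylinder probabilities of the selectors *)

Section BernoulliSelectors.
Context {R : realType} {dO : measure_display} {Omega : measurableType dO}.
Variables (P : probability Omega R) (a : R) (X : nat -> Omega -> R).
Hypothesis mX : forall n, measurable_fun setT (X n).
Hypothesis hX1 : forall n, (0 < n)%N -> P (X n @^-1` [set 1]) = ((n%:R) `^ (- a))%:E.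
Hypothesis hX0 : forall n, (0 < n)%N -> P (X n @^-1` [set 0]) = (1 - (n%:R) `^ (- a))%:E.
Hypothesis hind : indep_seq P X.

Let measurable_preX n (B : set R) : measurable B -> measurable (X n @^-1` B).
Proof. by move=> mB; rewrite -[_ @^-1` _]setTI; exact: mX. Qed.

Lemma bmf_selected n : bmf (fun w => (selected X w n)%:R : R).
Proof.
rewrite (_ : (fun _ => _) = \1_(X n.+1 @^-1` [set 1])).
  by apply: bmf_indic; apply: measurable_preX; exact: measurable_set1.
apply/funext => w; rewrite indicE /selected; congr (nat_of_bool _)%:R.
by apply/idP/idP => [/eqP h|/set_mem h]; [exact/mem_set | exact/eqP].
Qed.

Lemma indep_selected (L : seq nat) (v : nat -> bool) : uniq L ->
  \int[P]_w (all (fun i => selected X w i == v i) L)%:R =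
  \prod_(i <- L) (if v i then density a i else 1 - density a i).
Proof.
(* Non-selection is encoded as the complement of the value 1, so each cylinder condition is exactly
   an event on [X]; that the other value is 0 holds only almost surely. The predecessor undoes the
   shift from times to positions. *)
move=> uL; pose B j : set R := if v j.-1 then [set 1] else ~` [set 1].
have mB j : measurable (B j).
  by rewrite /B; case: (v _); [|apply: measurableC]; exact: measurable_set1.
pose J := [seq i.+1 | i <- L].
have uJ : uniq J by rewrite map_inj_uniq// => i j [].
have J0 j : j \in J -> (0 < j)%N by move=> /mapP[i _ ->].
have mC : measurable (\bigcap_(j in [set j | j \in J]) (X j @^-1` B j)).
  by apply: fin_bigcap_measurable => [|j _]; [exact: finite_seq | exact: measurable_preX].
transitivity (\int[P]_w (\1_(\bigcap_(j in [set j | j \in J]) (X j @^-1` B j)) w : R)).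
  apply: eq_Rintegral => w _; rewrite indicE; congr (nat_of_bool _)%:R.
  apply/idP/idP => [/allP h|/set_mem h].
    apply/mem_set => j /= /mapP[i iL ->]; rewrite /B /=.
    have := h i iL; rewrite /selected; case: (v i) => /eqP; first by move/eqP.
    by move=> n1 /= x1; rewrite x1 eqxx in n1.
  apply/allP => i iL; have := h i.+1 (map_f _ iL); rewrite /B /= /selected.
  by case: (v i) => /= [->|n1]; rewrite ?eqxx//; apply/eqP/negbTE/eqP.
rewrite mean_indic// hind// big_map.
have PB i : P (X i.+1 @^-1` B i.+1) = (if v i then density a i else 1 - density a i)%:E.
  rewrite /B /=; case: (v i); first by rewrite hX1.
  rewrite -preimage_setC probability_setC ?hX1//.
  by apply: measurable_preX; exact: measurable_set1.
under eq_bigr do rewrite PB.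
by rewrite prodEFin.
Qed.

Lemma ae_01 : {ae P, forall w, forall i, X i.+1 w = 1 \/ X i.+1 w = 0}.
Proof.
apply: ae_foralln => i.
have m1 := measurable_preX i.+1 (measurable_set1 (1 : R)).
have m0 := measurable_preX i.+1 (measurable_set1 (0 : R)).
have PU : P (X i.+1 @^-1` [set 1] `|` X i.+1 @^-1` [set 0]) = 1%E.
  rewrite measureU//; last first.
    by apply/seteqP; split => // w [/= -> /eqP]; rewrite oner_eq0.
  transitivity ((i.+1%:R `^ (- a))%:E + (1 - i.+1%:R `^ (- a))%:E)%E.
    by congr (_ + _)%E; [exact: hX1 | exact: hX0].
  by rewrite -EFinD addrC subrK.
exists (~` (X i.+1 @^-1` [set 1] `|` X i.+1 @^-1` [set 0])); split.
- by apply: measurableC; exact: measurableU.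
- apply: (etrans (probability_setC P (measurableU _ _ m1 m0))).
  by rewrite PU subee.
- by move=> w /= h [|] hw; apply: h; [left | right].
Qed.

End BernoulliSelectors.

Unset Implicit Arguments.

Theorem theorem1p1 (R : realType) (a : R) (ha : 0 < a < 1 / 14)
  (dO : measure_display) (Omega : measurableType dO) (P : probability Omega R)
  (X : nat -> Omega -> R)
  (mX : forall n, measurable_fun setT (X n))
  (hX1 : forall n, (0 < n)%N -> P (X n @^-1` [set 1]) = ((n%:R) `^ (- a))%:E)
  (hX0 : forall n, (0 < n)%N -> P (X n @^-1` [set 0]) = (1 - (n%:R) `^ (- a))%:E)
  (hind : indep_seq P X) :
  exists Omega0 : set Omega, measurable Omega0 /\ P Omega0 = 1%E /\
    forall w, Omega0 w ->
    forall (d : measure_display) (Y : measurableType d) (mu : probability Y R)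
      (T S : Y -> Y),
      measure_preserving mu T -> measure_preserving mu S ->
      T \o S = S \o T ->
      forall f g : Y -> R, Linfty mu f -> Linfty mu g ->
      forall ft gt : Y -> R,
        is_cond_exp_inv mu T f ft -> is_cond_exp_inv mu S g gt ->
        {ae mu, forall x,
          (fun N : nat => N%:R^-1 *
             \sum_(1 <= n < N.+1) f (iter n T x) * g (iter (rand_seq X w n) S x))
          @ \oo --> (ft x * gt x : R)}.
Proof.
have [q q0 hq] := ae_controlled ha (bmf_selected mX) (indep_selected mX hX1 hind).
(* Both properties concern omega alone. The complement of a measurable null set covering their
   failure is the required event, chosen before any system appears. *)
have [N [mN N0 hN]] := filterI hq (ae_01 mX hX1 hX0).
exists (~` N); split; first exact: measurableC.
split.
  have := probability_setC P mN; rewrite N0 => ->; by rewrite sube0.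
move=> w Nw d Y mu T S mT mS TS f g Lf Lg ft gt hft hgt.
have [he X01] : controlled a q (selected X w) /\ forall i, X i.+1 w = 1 \/ X i.+1 w = 0.
  by apply: contrapT => h; apply: Nw; apply: hN.
have [f' [ft' [bf bft ftT aef hf]]] := cond_exp_truncation Lf hft.
have [g' [gt' [bg bgt gtS aeg hg]]] := cond_exp_truncation Lg hgt.
have unb := count_unbounded ha q0 he mu.
have H1 := ae_comp_iter mT aef.
have H2 := ae_comp_iter mS aeg.
have H3 := ae_cnt_sum_little_o ha q0 he mT mS TS bf bft ftT hf bg bgt gtS hg.
apply: filterS2 (filterI H1 H2) H3 => x [hfx hgx] hx.
have := cnt_sum_little_o_index ha q0 he mu (fun m => (rand_seq_spec X01 unb m).1)
  (fun i => @rand_seq_selected _ _ _ _ X01 unb i) hx.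
move=> /little_o_cvg; rewrite (hfx 0%N).2 (hgx 0%N).2.
apply: cvg_trans; apply: near_eq_cvg; apply: nearW => n /=; congr (_ * _).
by apply: eq_bigr => i _; rewrite (hfx i).1 (hgx _).1.
Qed.
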